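(* Let $X$ be a transient Markov process with state space $E$ and Green function $(g(x,y),(x,y)\in E\times E)$. For every $\beta>0$ there exists a nonnegative process $(\psi_x,x\in E)$ such that for every $n$, every $(\alpha_1,\dots,\alpha_n)\in\mathbb{R}_+^n$ and every $(x_1,\dots,x_n)\in E^n$, $$\mathbb{E}\Big[\exp\{-\tfrac12\sum_{i=1}^n\alpha_i\psi_{x_i}\}\Big]=|I+\alpha G|^{-1/\beta},$$ where $I$ is the $n\times n$ identity matrix, $\alpha=\mathrm{diag}(\alpha_i)_{1\le i\le n}$ and $G=(g(x_i,x_j))_{1\le i,j\le n}$.
   Context: $|M|$ denotes the determinant of a square matrix $M$. The transient Markov process $X$ (not assumed symmetric) is assumed to admit a local time process $(L^x_t,x\in E,t\ge 0)$, and its Green function is the (finite) function $g(x,y)=\mathbb{E}_x(L^y_\infty)$, where $\mathbb{E}_x$ is the expectation under which $X$ starts at $x$. *)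

(* Defs.v *)
From HB Require Import structures.
From mathcomp Require Import all_boot all_order all_algebra.
From mathcomp Require Import all_classical all_reals all_analysis.

Set Implicit Arguments.
Unset Strict Implicit.
Unset Printing Implicit Defensive.

Import Order.TTheory GRing.Theory Num.Theory.
Import numFieldNormedType.Exports.

Local Open Scope classical_set_scope.
Local Open Scope ring_scope.

(* Time is [0, +oo[, represented by the t : R with 0 <= t; values of
   time-indexed families at negative times are irrelevant. *)

Section filtrations.
Context {R : realType} {d : measure_display} {Omega : measurableType d}.
Implicit Types (F : R -> set (set Omega)) (T : Omega -> \bar R).

Definition right_continuous_filtration F :=
  [/\ forall t, 0 <= t -> sigma_algebra setT (F t),
      forall t, 0 <= t -> F t `<=` measurable,
      forall s t, 0 <= s -> s <= t -> F s `<=` F t &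
      forall t (A : set Omega), 0 <= t -> (forall s, t < s -> F s A) -> F t A].

Definition stopping_time F T :=
  (forall w, (0 <= T w)%E) /\
  (forall t, 0 <= t -> F t [set w | (T w <= t%:E)%E]).

Definition stopped_sigma_algebra F T : set (set Omega) :=
  [set A | measurable A /\
     forall t, 0 <= t -> F t (A `&` [set w | (T w <= t%:E)%E])].

End filtrations.

Section markov_process.
Context {R : realType} {dE dO : measure_display}.

(* The cemetery is None; X_T is the cemetery when T = +oo. *)
Definition at_time (E : measurableType dE) (Omega : measurableType dO)
    (X : R -> Omega -> option E) (T : Omega -> \bar R) (w : Omega) : option E :=
  if T w is t%:E%E then X t w else None.

(* {T < lifetime} intersected with the preimage of Gam by the shift theta_T *)
Definition shifted_event (E : measurableType dE) (Omega : measurableType dO)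
    (X : R -> Omega -> option E) (theta : R -> Omega -> Omega)
    (T : Omega -> \bar R) (Gam : set Omega) : set Omega :=
  [set w | exists t, [/\ T w = t%:E%E, X t w <> None & Gam (theta t w)]].

(* Markov processes in the sense of Blumenthal and Getoor, normal and strong
   Markov, possibly with a finite lifetime.  No topology on E is needed.  For a
   right process, take for the sigma-algebras of Omega and E the usual
   completion of sigma(X_t, t >= 0) and the universally measurable sets. *)
Record strong_markov_process
    (E : measurableType dE) (Omega : measurableType dO) := StrongMarkovProcess {
  law : R.-pker E ~> Omega ;
  filt : R -> set (set Omega) ;
  coord : R -> Omega -> option E ;
  shift : R -> Omega -> Omega ;
  filtP : right_continuous_filtration filt ;
  coord_adapted : forall t (B : set E), 0 <= t -> measurable B ->
    filt t (coord t @^-1` (Some @` B)) ;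
  coord_killed : forall s t w, 0 <= s -> s <= t ->
    coord s w = None -> coord t w = None ;
  coord_shift : forall s t w, 0 <= s -> 0 <= t ->
    coord s (shift t w) = coord (s + t) w ;
  measurable_point : forall x : E, measurable [set x] ;
  law_start : forall x : E, {ae law x, forall w, coord 0 w = Some x} ;
  stopped_measurable : forall T (B : set E), stopping_time filt T ->
    measurable B ->
    stopped_sigma_algebra filt T (at_time coord T @^-1` (Some @` B)) ;
  shifted_measurable : forall T (Gam : set Omega), stopping_time filt T ->
    measurable Gam -> measurable (shifted_event coord shift T Gam) ;
  strong_markov : forall T (Gam A : set Omega) (x : E), stopping_time filt T ->
    measurable Gam -> stopped_sigma_algebra filt T A ->
    law x (A `&` shifted_event coord shift T Gam) =
    (\int[law x]_(w in A)
       if at_time coord T w is Some y then law y Gam else 0)%E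
}.

End markov_process.

Arguments strong_markov_process R {dE dO} E Omega.

Section local_times.
Context {R : realType} {dE dO : measure_display}.
Context {E : measurableType dE} {Omega : measurableType dO}.
Variable M : strong_markov_process R E Omega.

(* Every point is almost surely left for good. *)
Definition transient := forall x y : E,
  {ae law M x, forall w, exists t0, forall t, t0 < t -> coord M t w <> Some y}.

Record continuous_additive_functional (A : R -> Omega -> R) : Prop := {
  caf_adapted : forall t (B : set R), 0 <= t -> measurable B ->
    filt M t (A t @^-1` B) ;
  caf_path : forall x : E, {ae law M x, forall w,
    [/\ A 0 w = 0,
        forall s t, 0 <= s -> s <= t -> A s w <= A t w,
        {within `[0, +oo[, continuous (A ^~ w)} &
        forall s t, 0 <= s -> s <= t -> coord M s w = None ->
          A t w = A s w]} ;
  caf_additive : forall x : E, {ae law M x, forall w,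
    forall s t, 0 <= s -> 0 <= t ->
      A (t + s) w = A t w + A s (shift M t w)}
}.

Definition first_increase (A : R -> Omega -> R) (w : Omega) : \bar R :=
  ereal_inf [set t%:E%E | t in [set t : R | 0 <= t /\ 0 < A t w]].

(* A local time at y: a continuous additive functional with fine support {y} *)
Definition local_time_at (y : E) (A : R -> Omega -> R) :=
  [/\ continuous_additive_functional A,
      {ae law M y, forall w, first_increase A w = 0%E} &
      forall x, x <> y -> {ae law M x, forall w, first_increase A w <> 0%E}].

Definition local_time_process (L : E -> R -> Omega -> R) :=
  forall y, local_time_at y (L y).

(* Almost surely the limit of L^y_t as t tends to +oo, since t |-> L^y_t is
   nondecreasing; the supremum along integer times is measurable on all of
   Omega. *)
Definition total_local_time (L : E -> R -> Omega -> R) (y : E) (w : Omega) :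
    \bar R :=
  ereal_sup (range (fun n : nat => (L y n%:R w)%:E%E)).

Definition green (L : E -> R -> Omega -> R) (x y : E) : \bar R :=
  (\int[law M x]_w total_local_time L y w)%E.

End local_times.

(* Main.v *)
(* The transform |I + aG|^(-b), with b = 1/beta, is realised at once over all of E by
   a finitely additive law, which is then made countably additive on a Cantor space.

   For distinct points x_1, ..., x_k let T be the hitting time of {x_j, j <> i} under
   the law started at x_i. No local time at x_j, j <> i, accumulates before T while
   that at x_i is positive, so the strong Markov property at T gives
   (I - p) G = diag h with p >= 0 and h > 0. Hence, up to a constant,
   |I + aG| = prod_i (1 + a_i h_i) |I - z p| with z_i = 1 / (1 + a_i h_i).

   Laplace transforms of positive linear functionals on bounded functions are closed
   under sums, products and pointwise limits along filters (ultralimits). They contain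
   the gamma transforms (1 + a_i h_i)^(-b), and (1 - f)^(-b) = exp (b sum_n f^n / n)
   whenever they contain f with f < 1; pivoting one row at a time they contain
   |I - z p|^(-b). A limit over the finite subsets of E gives a single functional.

   Binary digits of exp(-v_x), x in E, send this functional to a content on the clopen
   sets of {0,1}^(E * nat), which is countably additive by compactness. *)
Require Import Defs.
From HB Require Import structures.
From mathcomp Require Import all_boot all_order all_algebra.
From mathcomp Require Import ring lra.
From mathcomp Require Import all_classical all_reals all_analysis.
From mathcomp Require Import measurable_realfun.
Set Implicit Arguments.
Unset Strict Implicit.
Unset Printing Implicit Defensive.

Import Order.TTheory GRing.Theory Num.Theory.
Import numFieldNormedType.Exports.
Local Open Scope classical_set_scope.
Local Open Scope ring_scope.

(** * Positive linear functionals and their Laplace transforms *)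

Section positive_functionals.
Context {R : realType} {V : Type}.
Implicit Types (f g : V -> R) (L : (V -> R) -> R).

Definition bounded_real f := exists C : R, forall v, `|f v| <= C.

(** Nothing is asked outside the bounded functions, and no continuity: such an [L] is a finitely
    additive measure of finite mass, not normalised. *)
Record positive_functional L : Prop := PositiveFunctional {
  pfD : forall f g, bounded_real f -> bounded_real g ->
    L (fun v => f v + g v) = L f + L g;
  pfZ : forall c f, bounded_real f -> L (fun v => c * f v) = c * L f;
  pf_ge0 : forall f, bounded_real f -> (forall v, 0 <= f v) -> 0 <= L f }.

Lemma bounded_realD f g : bounded_real f -> bounded_real g ->
  bounded_real (fun v => f v + g v).
Proof.
move=> [C fC] [D gD]; exists (C + D) => v.
by rewrite (le_trans (ler_normD _ _))// lerD.
Qed.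

Lemma bounded_realZ c f : bounded_real f -> bounded_real (fun v => c * f v).
Proof. by move=> [C fC]; exists (`|c| * C) => v; rewrite normrM ler_wpM2l. Qed.

Lemma bounded_real_cst c : bounded_real (fun=> c).
Proof. by exists `|c|. Qed.

Lemma bounded_real_sum (I : Type) (r : seq I) (F : I -> V -> R) :
  (forall i, bounded_real (F i)) -> bounded_real (fun v => \sum_(i <- r) F i v).
Proof.
move=> bF; elim: r => [|i r IH].
  by under eq_fun do rewrite big_nil; exact: bounded_real_cst.
by under eq_fun do rewrite big_cons; exact: bounded_realD.
Qed.

Section theory.
Variables (L : (V -> R) -> R) (pL : positive_functional L).

Lemma pf0 : L (fun=> 0) = 0.
Proof.
have := pfZ pL 0 (bounded_real_cst 0).
by rewrite !mul0r.
Qed.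

Lemma pf_cst c : L (fun=> c) = c * L (fun=> 1).
Proof. by rewrite -(pfZ pL) ?mulr1//; exact: bounded_real_cst. Qed.

Lemma pf_le f g : bounded_real f -> bounded_real g -> (forall v, f v <= g v) ->
  L f <= L g.
Proof.
move=> bf bg fg; have bNf : bounded_real (fun v => -1 * f v) by exact: bounded_realZ.
have := pf_ge0 pL (bounded_realD bg bNf).
rewrite (pfD pL)// (pfZ pL)// mulN1r subr_ge0; apply => v.
by rewrite mulN1r subr_ge0.
Qed.

Lemma pf_norm f C : (forall v, `|f v| <= C) -> `|L f| <= C * L (fun=> 1).
Proof.
move=> fC; have bf : bounded_real f by exists C.
rewrite ler_norml -mulNr -!pf_cst; apply/andP; split; apply: pf_le => //.
- exact: bounded_real_cst.
- by move=> v; have := fC v; rewrite ler_norml => /andP[].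
- exact: bounded_real_cst.
- by move=> v; have := fC v; rewrite ler_norml => /andP[].
Qed.

Lemma pf_sum (I : Type) (r : seq I) (F : I -> V -> R) :
  (forall i, bounded_real (F i)) ->
  L (fun v => \sum_(i <- r) F i v) = \sum_(i <- r) L (F i).
Proof.
move=> bF; elim: r => [|i r IH].
  by under eq_fun do rewrite big_nil; rewrite big_nil pf0.
under eq_fun do rewrite big_cons.
by rewrite big_cons -IH (pfD pL)//; exact: bounded_real_sum.
Qed.

End theory.

Lemma pf_eval v : positive_functional (fun f => f v).
Proof. by split. Qed.

Lemma pf_scale c L : 0 <= c -> positive_functional L ->
  positive_functional (fun f => c * L f).
Proof.
move=> c0 pL; split => [f g bf bg|a f bf|f bf f0].
- by rewrite (pfD pL)// mulrDr.
- by rewrite (pfZ pL)// mulrCA.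
- by rewrite mulr_ge0// (pf_ge0 pL).
Qed.

Lemma pf_add L1 L2 : positive_functional L1 -> positive_functional L2 ->
  positive_functional (fun f => L1 f + L2 f).
Proof.
move=> p1 p2; split => [f g bf bg|a f bf|f bf f0].
- by rewrite (pfD p1)// (pfD p2)// addrACA.
- by rewrite (pfZ p1)// (pfZ p2)// mulrDr.
- by rewrite addr_ge0// ?(pf_ge0 p1)// (pf_ge0 p2).
Qed.

(** With pointwise addition for [op], this iterated functional is the convolution. The inner
    integral is bounded by [C * L2 (fun=> 1)], so the axioms of [L1] apply to it. *)
Lemma pf_convolution (op : V -> V -> V) L1 L2 :
  positive_functional L1 -> positive_functional L2 ->
  positive_functional (fun f => L1 (fun u => L2 (fun v => f (op u v)))).
Proof.
move=> p1 p2.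
have bop f u : bounded_real f -> bounded_real (fun v => f (op u v)).
  by move=> [C fC]; exists C.
have bL2 f : bounded_real f ->
    bounded_real (fun u => L2 (fun v => f (op u v))).
  by move=> [C fC]; exists (C * L2 (fun=> 1)) => u; exact: pf_norm.
split => [f g bf bg|a f bf|f bf f0].
- rewrite -(pfD p1); [|exact: bL2..]; congr L1; apply/funext => u.
  by rewrite (pfD p2)//; exact: bop.
- rewrite -(pfZ p1); [|exact: bL2..]; congr L1; apply/funext => u.
  by rewrite (pfZ p2)//; exact: bop.
- apply: (pf_ge0 p1); first exact: bL2.
  by move=> u; apply: (pf_ge0 p2) => //; exact: bop.
Qed.

(* Bounded nets of positive functionals converge along an ultrafilter, by
   compactness of segments; this replaces weak limits of measures. *)
Lemma pf_ultralimit {J : Type} (U : set_system J) {FU : UltraFilter U}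
    (L : J -> (V -> R) -> R) (C : R) :
  (forall j, positive_functional (L j)) ->
  (\forall j \near U, L j (fun=> 1) <= C) ->
  let Lu f := lim (L j f @[j --> U]) in
  (forall f, bounded_real f -> L j f @[j --> U] --> Lu f) /\
  positive_functional Lu.
Proof.
move=> pL LC Lu; have PU : ProperFilter U by exact: ultra_proper.
have cvL f : bounded_real f -> L j f @[j --> U] --> Lu f.
  move=> [B fB].
  have UF : UltraFilter (L j f @[j --> U]).
    split; first exact: fmap_proper_filter.
    move=> G PG sG; apply/seteqP; split => [A GA|//].
    have [//|] := in_ultra_setVsetC ((fun j => L j f) @^-1` A) FU.
    move=> UnA; have GnA : G (~` A) by exact: sG.
    by have [x [? ?]] := filter_ex (filterI GA GnA).
  have : compact `[- (`|B| * `|C|), `|B| * `|C|] by exact: segment_compact.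
  rewrite compact_ultra => /(_ _ UF)[|l [_ lF]]; last by apply: (cvgP l).
  rewrite nbhs_filterE/=; apply: filterS LC => j LjC; rewrite /= in_itv/= -ler_norml.
  have L10 : 0 <= L j (fun=> 1) by apply: (pf_ge0 (pL j)) => //; exact: bounded_real_cst.
  rewrite (le_trans (pf_norm (pL j) fB))//.
  rewrite (le_trans (ler_norm _))// normrM ler_wpM2l// ger0_norm//.
  exact: le_trans LjC (ler_norm C).
split=> //; split => [f g bf bg|a f bf|f bf f0].
- apply/cvg_lim => //.
  under eq_fun do rewrite (pfD (pL _) bf bg).
  by apply: cvgD; exact: cvL.
- apply/cvg_lim => //.
  under eq_fun do rewrite (pfZ (pL _) _ bf).
  by apply: cvgMr; exact: cvL.
- apply: limr_ge; first by apply/cvg_ex; exists (Lu f); exact: cvL.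
  by apply: nearW => j; exact: (pf_ge0 (pL j)).
Qed.

End positive_functionals.

(** * Laplace transforms and their closure properties *)

Section laplace_transforms.
Context {R : realType} {E : Type}.

(* A test encodes a finite nonnegative combination of evaluations on
   [E -> {nonneg R}]; a point of [E] may occur several times. *)
Definition test := seq (E * {nonneg R}).

Definition pairing (t : test) (v : E -> {nonneg R}) : R :=
  \sum_(p <- t) p.2%:num * (v p.1)%:num.

(** The empty test pairs to 0 with every vector, so [phi [::]] is the total mass of [L]. *)
Definition laplace (phi : test -> R) := exists2 L : ((E -> {nonneg R}) -> R) -> R,
  positive_functional L & forall t, L (fun v => expR (- pairing t v)) = phi t.

Implicit Types (phi : test -> R) (t : test).

Lemma pairing_ge0 t v : 0 <= pairing t v.
Proof. by apply: sumr_ge0 => p _; rewrite mulr_ge0. Qed.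

Lemma pairing0 v : pairing [::] v = 0.
Proof. exact: big_nil. Qed.

Lemma bounded_character t : bounded_real (fun v => expR (- pairing t v)).
Proof.
exists 1 => v.
by rewrite ger0_norm ?expR_ge0// expR_le1 oppr_le0 pairing_ge0.
Qed.

Lemma laplace_ge0 phi t : laplace phi -> 0 <= phi t.
Proof.
move=> [L pL <-]; apply: (pf_ge0 pL) => [|v]; first exact: bounded_character.
exact: expR_ge0.
Qed.

Lemma laplace_le phi t : laplace phi -> phi t <= phi [::].
Proof.
move=> [L pL Lphi]; rewrite -!Lphi; apply: (pf_le pL); try exact: bounded_character.
by move=> v; rewrite pairing0 oppr0 expR0 expR_le1 oppr_le0 pairing_ge0.
Qed.

Lemma laplace_point v : laplace (fun t => expR (- pairing t v)).
Proof. by exists (fun f => f v) => //; exact: pf_eval. Qed.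

Lemma laplaceZ c phi : 0 <= c -> laplace phi -> laplace (fun t => c * phi t).
Proof.
move=> c0 [L pL Lphi]; exists (fun f => c * L f); first exact: pf_scale.
by move=> t; rewrite Lphi.
Qed.

Lemma laplace1 : laplace (fun=> 1).
Proof.
rewrite (_ : (fun=> 1) = fun t => expR (- pairing t (fun=> 0%:nng))).
  exact: laplace_point.
apply/funext => t.
by rewrite /pairing big1 ?oppr0 ?expR0// => p _; rewrite mulr0.
Qed.

Lemma laplace_cst c : 0 <= c -> laplace (fun=> c).
Proof.
by move=> c0; have := laplaceZ c0 laplace1; rewrite mulr1.
Qed.

Lemma laplaceD phi1 phi2 : laplace phi1 -> laplace phi2 ->
  laplace (fun t => phi1 t + phi2 t).
Proof.
move=> [L1 p1 e1] [L2 p2 e2]; exists (fun f => L1 f + L2 f); first exact: pf_add.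
by move=> t; rewrite e1 e2.
Qed.

(** Convolution under pointwise addition: characters turn sums of vectors into products. *)
Lemma laplaceM phi1 phi2 : laplace phi1 -> laplace phi2 ->
  laplace (fun t => phi1 t * phi2 t).
Proof.
move=> [L1 p1 e1] [L2 p2 e2].
have uv0 (u v : E -> {nonneg R}) x : 0 <= (u x)%:num + (v x)%:num by [].
pose op u v x := NngNum (uv0 u v x).
exists (fun f => L1 (fun u => L2 (fun v => f (op u v)))).
  exact: (pf_convolution op p1 p2).
move=> t; rewrite -e1 -e2 [RHS]mulrC -(pfZ p1); last exact: bounded_character.
congr L1; apply/funext => u; rewrite [RHS]mulrC -(pfZ p2); last exact: bounded_character.
congr L2; apply/funext => v; rewrite -expRD -opprD; congr (expR (- _)).
by rewrite /pairing -big_split/=; apply: eq_bigr => p _; rewrite mulrDr.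
Qed.

Lemma laplaceX phi n : laplace phi -> laplace (fun t => phi t ^+ n).
Proof.
move=> lphi; elim: n => [|n IH]; first by under eq_fun do rewrite expr0; exact: laplace1.
by under eq_fun do rewrite exprS; exact: laplaceM.
Qed.

Lemma laplace_sum (I : Type) (r : seq I) (P : pred I) (F : I -> test -> R) :
  (forall i, P i -> laplace (F i)) -> laplace (fun t => \sum_(i <- r | P i) F i t).
Proof.
move=> lF; elim: r => [|i r IH].
  by under eq_fun do rewrite big_nil; exact: laplace_cst.
under eq_fun do rewrite big_cons.
by case: (boolP (P i)) => // Pi; apply: laplaceD => //; exact: lF.
Qed.

Lemma laplace_prod (I : Type) (r : seq I) (F : I -> test -> R) :
  (forall i, laplace (F i)) -> laplace (fun t => \prod_(i <- r) F i t).
Proof.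
move=> lF; elim: r => [|i r IH].
  by under eq_fun do rewrite big_nil; exact: laplace1.
by under eq_fun do rewrite big_cons; exact: laplaceM.
Qed.

(** The masses [phi j [::]] converge, hence are eventually bounded, and an ultrafilter finer than
    [F] yields a limit functional. Finite additivity survives the limit without any tightness. *)
Lemma laplace_cvg {J : Type} (F : set_system J) {FF : ProperFilter F}
    (phi : J -> test -> R) (psi : test -> R) :
  (forall j, laplace (phi j)) -> (forall t, phi j t @[j --> F] --> psi t) ->
  laplace psi.
Proof.
move=> lphi cvphi.
have /choice[L LP] : forall j, exists L, positive_functional L /\
    forall t, L (fun v => expR (- pairing t v)) = phi j t.
  by move=> j; have [L pL e] := lphi j; exists L.
have [U [UU sFU]] := ultraFilterLemma FF.
have L1 j : L j (fun=> 1) = phi j [::].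
  rewrite -(LP j).2; congr (L j); apply/funext => v.
  by rewrite pairing0 oppr0 expR0.
have LC : \forall j \near U, L j (fun=> 1) <= psi [::] + 1.
  apply: sFU; near=> j; rewrite L1 ltW//.
  near: j; apply: (cvgr_lt (psi [::])); first exact: cvphi.
  by rewrite ltrDl.
have [cvL pL] := @pf_ultralimit _ _ J U UU L _ (fun j => (LP j).1) LC.
exists (fun f => lim (L j f @[j --> U])) => // t.
have PU : ProperFilter U by exact: ultra_proper.
apply/cvg_lim => //; under eq_fun do rewrite (LP _).2.
exact: cvg_trans (cvg_app _ sFU) (cvphi t).
Unshelve. all: by end_near. Qed.

End laplace_transforms.

(** * Logarithmic and exponential limits *)

Section real_limits.
Context {R : realType}.

Lemma is_derive_log_partial_sum (n : nat) (y : R) :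
  is_derive y 1 (fun z => \sum_(k < n) z ^+ k.+1 / k.+1%:R) (\sum_(k < n) y ^+ k).
Proof.
elim: n => [|n IH].
  by under eq_fun do rewrite big_ord0; rewrite big_ord0; exact: is_derive_cst.
under eq_fun do rewrite big_ord_recr/=.
rewrite big_ord_recr/=; apply: is_deriveD.
under eq_fun do rewrite mulrC.
have -> : y ^+ n = n.+1%:R^-1 *: ((n.+1%:R * y ^+ n) *: 1).
  by rewrite /GRing.scale/= mulr1 mulrA mulVf ?mul1r// pnatr_eq0.
have -> : (fun z : R => n.+1%:R^-1 * z ^+ n.+1) = n.+1%:R^-1 *: (id ^+ n.+1 : R -> R).
  by apply/funext => z; rewrite !fctE.
exact: is_deriveZ.
Qed.

Lemma cvg_log_series (x : R) : 0 <= x < 1 ->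
  (\sum_(k < n) x ^+ k.+1 / k.+1%:R) @[n --> \oo] --> - ln (1 - x).
Proof.
move=> /andP[x0 x1].
(* The remainder [h n] of the logarithmic series vanishes at 0 and has derivative
   [z ^+ n / (1 - z)], so the mean value theorem bounds it by [x ^+ n / (1 - x)]. *)
pose h n z : R := - ln (1 - z) - \sum_(k < n) z ^+ k.+1 / k.+1%:R.
have h0 n : h n 0 = 0.
  rewrite /h subr0 ln1 oppr0 sub0r big1 ?oppr0// => k _.
  by rewrite expr0n/= mul0r.
have dh (n : nat) (z : R) : z < 1 -> is_derive z 1 (h n) (z ^+ n / (1 - z)).
  move=> z1; have z1' : 0 < 1 - z by rewrite subr_gt0.
  have -> : z ^+ n / (1 - z) = - ((1 - z)^-1 * (0 - 1)) - \sum_(k < n) z ^+ k.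
    have e : (1 - z) * (\sum_(k < n) z ^+ k) = 1 - z ^+ n.
      by rewrite -opprB mulNr -subrX1 opprB.
    have -> : z ^+ n = 1 - (1 - z) * (\sum_(k < n) z ^+ k) by rewrite e; ring.
    by field; rewrite gt_eqF.
  apply: is_deriveB; last exact: is_derive_log_partial_sum.
  apply: is_deriveN.
  apply: (@is_derive1_comp _ (@ln R) (fun w => 1 - w)).
  exact: is_derive1_ln.
have hb n : 0 <= h n x <= x ^+ n / (1 - x).
  have [x00|x_gt0] := eqVneq x 0.
    by rewrite x00 h0 lexx/= subr0 divr1 exprn_ge0.
  have {}x_gt0 : 0 < x by rewrite lt_neqAle eq_sym x_gt0.
  have [| |c cx] := @MVT _ (h n) (fun z => z ^+ n / (1 - z)) 0 x x_gt0.
  - by move=> z; rewrite in_itv/= => /andP[_ zx]; apply: dh; exact: lt_trans zx x1.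
  - apply: derivable_within_continuous => z; rewrite in_itv/= => /andP[_ zx].
    by apply: (@ex_derive _ _ _ _ _ _ _ (dh n z _)); exact: le_lt_trans zx x1.
  rewrite h0 !subr0 => ->; move: cx; rewrite in_itv/= => /andP[c0 cx].
  have c1 : 0 < 1 - c by rewrite subr_gt0 (lt_trans cx).
  rewrite mulr_ge0 ?divr_ge0 ?exprn_ge0 ?(ltW c0) ?(ltW c1)//=.
  have x1' : 0 < 1 - x by rewrite subr_gt0.
  rewrite -[leRHS]mulr1 ler_pM ?divr_ge0 ?exprn_ge0 ?(ltW c0) ?(ltW c1) ?(ltW x1)//.
  rewrite ler_pM ?invr_ge0 ?exprn_ge0 ?(ltW c0) ?(ltW c1)//.
    by rewrite lerXn2r ?nnegrE ?(ltW c0) ?(ltW cx).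
  by rewrite lef_pV2 ?posrE// lerD2l lerN2 ltW.
have : h n x @[n --> \oo] --> 0.
  apply: (@squeeze_cvgr _ _ _ _ (fun=> 0) (fun n => x ^+ n / (1 - x))).
  - by near=> n; exact: hb.
  - exact: cvg_cst.
  - rewrite -(mul0r (1 - x)^-1); apply: cvgMl.
    have -> : GRing.exp x = geometric 1 x by apply/funext => n; rewrite /= mul1r.
    by apply: cvg_geometric; rewrite ger0_norm.
move=> /(cvgB (@cvg_cst _ (- ln (1 - x)) nat \oo _)); rewrite subr0.
by apply: cvg_trans; apply: near_eq_cvg; near=> n; rewrite /h/= opprB addrC subrK.
Unshelve. all: by end_near. Qed.

Lemma cvg_expR_series (x : R) : series (exp_coeff x) n @[n --> \oo] --> expR x.
Proof. exact: is_cvg_series_exp_coeff. Qed.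

Lemma continuous_powR_base (r x : R) : 0 < x -> {for x, continuous (@powR R ^~ r)}.
Proof.
move=> x0; apply: differentiable_continuous; apply/derivable1_diffP.
by apply: derivable_powR; rewrite in_itv/= x0.
Qed.

Lemma cvg_1BexpRN (c : R) : 0 <= c ->
  n.+1%:R * (1 - expR (- (c / n.+1%:R))) @[n --> \oo] --> c.
Proof.
move=> c0; have cvh : n.+1%:R^-1 @[n --> \oo] --> (0 : R) by exact: cvg_harmonic.
apply: (@squeeze_cvgr _ _ _ _ (fun n => c - c ^+ 2 * n.+1%:R^-1) (fun=> c)).
- near=> n; have n0 : 0 < n.+1%:R :> R by rewrite ltr0n.
  set a := c / n.+1%:R.
  have a0 : 0 <= a by rewrite divr_ge0// ltW.
  have -> : c = n.+1%:R * a by rewrite /a mulrCA mulfV ?mulr1// gt_eqF.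
  have -> : n.+1%:R * a - (n.+1%:R * a) ^+ 2 / n.+1%:R = n.+1%:R * (a - a ^+ 2).
    by field; rewrite lt0r_neq0.
  rewrite !ler_pM2l//; apply/andP; split; last by have := expR_ge1Dx (- a); lra.
  (* Hence [1 - expR (- a)] is at least [a / (1 + a)], which is at least [a - a ^+ 2]. *)
  have ea : expR (- a) * (1 + a) <= 1.
    by rewrite expRN ler_pdivrMl ?expR_gt0// mulr1 expR_ge1Dx.
  have := expR_gt0 (- a); nra.
- rewrite -[X in _ --> X]subr0 -(mulr0 (c ^+ 2)).
  by apply: cvgB; [exact: cvg_cst|exact: cvgMr].
- exact: cvg_cst.
Unshelve. all: by end_near. Qed.

End real_limits.

(** * Real powers of Laplace transforms and of determinants *)

Section laplace_powers.
Context {R : realType} {E : Type}.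
Implicit Types (phi : @test R E -> R) (t : @test R E).

Lemma laplace_expR phi : laplace phi -> laplace (fun t => expR (phi t)).
Proof.
move=> lphi.
apply: (@laplace_cvg _ _ _ (\oo : set_system nat) _
    (fun n t => \sum_(0 <= k < n) exp_coeff (phi t) k)).
  move=> n; apply: laplace_sum => k _.
  rewrite (_ : (fun t => _) = fun t => (k`!%:R)^-1 * phi t ^+ k).
    by apply: laplaceZ; [rewrite invr_ge0|exact: laplaceX].
  by apply/funext => t; rewrite mulrC.
by move=> t; exact: cvg_expR_series.
Qed.

(** A transform is largest at the empty test, so the single condition [phi [::] < 1] makes the
    logarithmic series converge at every test. Its coefficients and those of the exponential are
    nonnegative. *)
Lemma laplace_powR1BN phi (b : R) : laplace phi -> phi [::] < 1 -> 0 <= b ->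
  laplace (fun t => (1 - phi t) `^ (- b)).
Proof.
move=> lphi phi1 b0.
have phi01 t : 0 <= phi t < 1.
  by rewrite laplace_ge0//= (le_lt_trans (laplace_le _ lphi)).
have -> : (fun t => (1 - phi t) `^ (- b)) = (fun t => expR (b * - ln (1 - phi t))).
  apply/funext => t; rewrite /powR gt_eqF; first by rewrite mulNr mulrN.
  by rewrite subr_gt0; have /andP[] := phi01 t.
apply: laplace_expR; apply: laplaceZ => //.
apply: (@laplace_cvg _ _ _ (\oo : set_system nat) _
    (fun n t => \sum_(k < n) phi t ^+ k.+1 / k.+1%:R)).
  move=> n; apply: laplace_sum => k _.
  rewrite (_ : (fun t => _) = fun t => k.+1%:R^-1 * phi t ^+ k.+1).
    by apply: laplaceZ; [rewrite invr_ge0|exact: laplaceX].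
  by apply/funext => t; rewrite mulrC.
by move=> t; exact: cvg_log_series.
Qed.

Definition dirac_vector (e : E) (c : {nonneg R}) (y : E) : {nonneg R} :=
  if `[< y = e >] then c else 0%:nng.

(** The coefficient of the coordinate [e], repeated occurrences being added up: it plays the part of
    the Laplace variable attached to [e]. *)
Definition mass (t : @test R E) (e : E) : R :=
  \sum_(p <- t) if `[< p.1 = e >] then p.2%:num else 0.

Lemma mass_ge0 t e : 0 <= mass t e.
Proof. by apply: sumr_ge0 => p _; case: ifP. Qed.

Lemma mass_nil e : mass [::] e = 0.
Proof. exact: big_nil. Qed.

Lemma pairing_dirac t e (c : {nonneg R}) :
  pairing t (dirac_vector e c) = c%:num * mass t e.
Proof.
rewrite /pairing mulr_sumr; apply: eq_bigr => p _; rewrite /dirac_vector.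
by case: asboolP => _ /=; rewrite ?mulr0// mulrC.
Qed.

(* The Laplace transform of a gamma law is the limit of those of rescaled
   negative binomial laws. *)
Lemma laplace_gamma (h b : R) e : 0 <= h -> 0 <= b ->
  laplace (fun t => (1 + h * mass t e) `^ (- b)).
Proof.
move=> h0 b0.
(* [x n] is the character of the vector equal to [h / n.+1] at [e] and 0 elsewhere. As [1 - q n] is
   the inverse of [n.+1], the power of [n.+1] used below normalises the negative binomial law of
   parameter [q n]. *)
pose x n t := expR (- (h * mass t e / n.+1%:R)).
pose q n : R := 1 - n.+1%:R^-1.
have q0 n : 0 <= q n by rewrite subr_ge0 invf_le1 ?ler1n ?ltr0n.
have lx n : laplace (x n).
  have hn0 : 0 <= h / n.+1%:R by rewrite divr_ge0.
  have -> : x n = fun t => expR (- pairing t (dirac_vector e (NngNum hn0))).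
    by apply/funext => t; rewrite pairing_dirac /x/= mulrAC.
  exact: laplace_point.
apply: (@laplace_cvg _ _ _ (\oo : set_system nat) _
    (fun n t => n.+1%:R `^ (- b) * (1 - q n * x n t) `^ (- b))).
  move=> n; apply: laplaceZ; first exact: powR_ge0.
  apply: laplace_powR1BN => //; first exact: (laplaceZ (q0 n) (lx n)).
  rewrite /x mass_nil mulr0 mul0r oppr0 expR0 mulr1 /q.
  by rewrite gtrBl invr_gt0 ltr0n.
move=> t; set a := h * _.
have a0 : 0 <= a by rewrite mulr_ge0// mass_ge0.
have x1 n : x n t <= 1 by rewrite expR_le1 oppr_le0 divr_ge0.
(* The two terms on the right tend to [a] and to 1. *)
have xE n : n.+1%:R * (1 - q n * x n t) =
    n.+1%:R * (1 - expR (- (a / n.+1%:R))) + expR (- (a / n.+1%:R)).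
  have : n.+1%:R != 0 :> R by rewrite pnatr_eq0.
  by rewrite /q /x -/a; move: n.+1%:R => N N0; field.
have cv : n.+1%:R * (1 - q n * x n t) @[n --> \oo] --> 1 + a.
  under eq_fun do rewrite xE; rewrite addrC; apply: cvgD; first exact: cvg_1BexpRN.
  rewrite -[X in _ --> X]expR0; apply: continuous_cvg; first exact: continuous_expR.
  rewrite -[X in _ --> X]oppr0; apply: cvgN; rewrite -(mulr0 a); apply: cvgMr.
  exact: cvg_harmonic.
have {}cv : (n.+1%:R * (1 - q n * x n t)) `^ (- b) @[n --> \oo] --> (1 + a) `^ (- b).
  apply: (@continuous_cvg _ _ _ _ _ _ (@powR R ^~ (- b)) _ _ cv).
  by apply: continuous_powR_base; rewrite ltr_wpDr.
apply: cvg_trans cv; apply: near_eq_cvg; near=> n; rewrite powRM//.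
rewrite subr_ge0 mulr_ile1// ?expR_ge0//.
by rewrite lerBlDl lerDr invr_ge0.
Unshelve. all: by end_near. Qed.

Lemma det_block_schur (F : fieldType) (n : nat) (p : F) (r : 'rV[F]_n)
    (c : 'cV[F]_n) (D : 'M[F]_n) : p != 0 ->
  \det (block_mx p%:M r c D) = p * \det (D - p^-1 *: (c *m r)).
Proof.
move=> p0.
have -> : block_mx p%:M r c D =
    block_mx 1%:M 0 (p^-1 *: c) 1%:M *m block_mx p%:M r 0 (D - p^-1 *: (c *m r)).
  rewrite mulmx_block !mul1mx !mul0mx !addr0.
  rewrite mul_mx_scalar scalerA mulfV// scale1r -scalemxAl.
  by rewrite addrC subrK.
by rewrite det_mulmx det_lblock det_ublock !det1 !mul1r det_scalar1.
Qed.

(* [u] witnesses that [1 - A [::]] is a nonsingular M-matrix; this passes to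
   Schur complements, and the pivot is an admissible power of [1 - phi]. *)
Lemma laplace_det_powRN (b : R) (n : nat) (A : @test R E -> 'M[R]_n) (u : 'cV[R]_n) :
  0 <= b -> (forall i j, laplace (fun t => A t i j)) ->
  (forall i, 0 < u i 0) -> (forall i, (A [::] *m u) i 0 < u i 0) ->
  (forall t, 0 < \det (1%:M - A t)) /\
  laplace (fun t => \det (1%:M - A t) `^ (- b)).
Proof.
move=> b0; elim: n => [|n IH] in A u *.
  move=> lA u0 Au; split; first by move=> t; rewrite det_mx00.
  by under eq_fun do rewrite det_mx00 powR1; exact: laplace1.
move=> lA u0 Au.
pose B t : 'M[R]_(1 + n) := A t; pose w : 'cV[R]_(1 + n) := u.
pose i0 : 'I_1 := 0.
have lB i j : laplace (fun t => B t i j) by exact: lA.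
pose f t := B t (lshift n i0) (lshift n i0).
have lf : laplace f by exact: lB.
(* [1 - A'] is the Schur complement of the pivot [1 - f] in [1 - B]. *)
pose A' t := drsubmx (B t) + (1 - f t)^-1 *: (dlsubmx (B t) *m ursubmx (B t)).
have Bw (i : 'I_(1 + n)) : (B [::] *m w) i 0 < w i 0 by exact: Au.
have w0 : 0 < usubmx w 0 0 by rewrite mxE; exact: u0.
have w1 i : 0 < dsubmx w i 0 by rewrite mxE; exact: u0.
have Bww : B [::] *m w = col_mx
    (ulsubmx (B [::]) *m usubmx w + ursubmx (B [::]) *m dsubmx w)
    (dlsubmx (B [::]) *m usubmx w + drsubmx (B [::]) *m dsubmx w).
  by rewrite -mul_block_col submxK vsubmxK.
have Bw0 : f [::] * usubmx w 0 0 + (ursubmx (B [::]) *m dsubmx w) 0 0 < usubmx w 0 0.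
  have := Bw (lshift n i0); rewrite Bww col_mxEu mxE [X in X + _ < _]mxE big_ord1.
  rewrite [X in X * _ + _ < _]mxE [X in X * _ + _ < _]mxE.
  by rewrite (_ : w (lshift n i0) 0 = usubmx w 0 0)// mxE.
have Bw1 i : (dlsubmx (B [::]) *m usubmx w) i 0 + (drsubmx (B [::]) *m dsubmx w) i 0
    < dsubmx w i 0.
  have := Bw (rshift 1 i); rewrite Bww col_mxEd mxE.
  by rewrite (_ : w (rshift 1 i) 0 = dsubmx w i 0)// mxE.
have B0 i j : 0 <= B [::] i j by exact: (laplace_ge0 _ (lB i j)).
have rw0 : 0 <= (ursubmx (B [::]) *m dsubmx w) 0 0.
  rewrite mxE sumr_ge0// => j _; rewrite mulr_ge0 ?(ltW (w1 _))// !mxE; exact: B0.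
have f1 : f [::] < 1.
  by rewrite -(ltr_pM2r w0) mul1r; apply: le_lt_trans Bw0; rewrite lerDl.
have f1t t : 0 < 1 - f t by rewrite subr_gt0 (le_lt_trans (laplace_le _ lf)).
have detE t : \det (1%:M - A t) = (1 - f t) * \det (1%:M - A' t).
  have e : (1%:M : 'M[R]_(1 + n)) - B t = block_mx (1 - f t)%:M
      (- ursubmx (B t)) (- dlsubmx (B t)) (1%:M - drsubmx (B t)).
    rewrite -{1}[B t]submxK scalar_mx_block opp_block_mx add_block_mx !add0r.
    congr block_mx; apply/matrixP => i j.
    by rewrite !ord1 !mxE/= !mulr1n.
  rewrite -[1%:M - A t]/((1%:M : 'M[R]_(1 + n)) - B t) e.
  rewrite (det_block_schur _ _ _ (lt0r_neq0 (f1t t))) mulNmx mulmxN opprK.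
  by rewrite /A' opprD addrA.
have [|||d' l'] := IH A' (dsubmx w).
- move=> i j; rewrite /A'.
  under eq_fun do rewrite 3!mxE [X in _ + X]mxE mxE big_ord1 !mxE.
  apply: laplaceD => //; apply: laplaceM; last exact: laplaceM.
  have -> : (fun t => (1 - f t)^-1) = fun t => (1 - f t) `^ (- 1).
    by apply/funext => t; rewrite powR_inv1// ltW.
  exact: laplace_powR1BN.
- exact: w1.
(* The first row of the inequality for [w] bounds [ursubmx (B [::]) *m dsubmx w] by [1 - f [::]]
   times the head of [w]. Inserted in the remaining rows, this gives the inequality for [A'
   [::]]. *)
- move=> i; rewrite /A' mulmxDl mxE -scalemxAl -mulmxA.
  apply: le_lt_trans (Bw1 i); rewrite addrC lerD2r mxE ler_pdivrMl ?f1t//.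
  rewrite [X in X <= _]mxE [X in _ <= _ * X]mxE !big_ord1 mulrCA ler_wpM2l//.
    by rewrite !mxE.
  by rewrite mulrBl mul1r lerBrDl ltW.
split=> [t|]; first by rewrite detE mulr_gt0.
under eq_fun do rewrite detE powRM ?(ltW (f1t _)) ?(ltW (d' _))//.
by apply: laplaceM => //; exact: laplace_powR1BN.
Qed.

End laplace_powers.

(** * Permanental Laplace transforms of Green matrices *)

Section laplace_green.
Context {R : realType}.

Lemma powR_prod (I : Type) (s : seq I) (F : I -> R) (r : R) :
  (forall i, 0 <= F i) -> (\prod_(i <- s) F i) `^ r = \prod_(i <- s) F i `^ r.
Proof.
move=> F0; elim: s => [|i s IH]; first by rewrite !big_nil powR1.
by rewrite !big_cons powRM ?IH// prodr_ge0.
Qed.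

Lemma laplace_det_green (E : Type) (b : R) (k : nat) (x : 'I_k -> E)
    (G p : 'M[R]_k) (h : 'rV[R]_k) : 0 <= b ->
  (forall i j, 0 <= p i j) -> (forall i, 0 < h 0 i) -> (forall i j, 0 <= G i j) ->
  (1%:M - p) *m G = diag_mx h ->
  laplace (fun t => \det (1%:M + diag_mx (\row_i mass t (x i)) *m G) `^ (- b)).
Proof.
move=> b0 p0 h0 G0 pG.
pose m t : 'rV[R]_k := \row_i mass t (x i).
pose d t i : R := 1 + h 0 i * mass t (x i).
have d0 t i : 0 < d t i by rewrite ltr_pwDl// mulr_ge0 ?mass_ge0// ltW.
pose A t : 'M[R]_k := \matrix_(i, j) ((d t i)^-1 * p i j).
pose one : 'cV[R]_k := const_mx 1.
(* The row sums of [G]: the factorisation gives [u - p *m u = h^T], which is positive, so [u] is the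
   witness for the M-matrix property. *)
pose u : 'cV[R]_k := G *m one.
have pu : u = p *m u + h^T.
  have -> : h^T = (1%:M - p) *m u.
    rewrite mulmxA pG; apply/matrixP => i j; rewrite ord1 mxE [RHS]mxE.
    rewrite (bigD1 i)//= !mxE eqxx mulr1 big1 ?addr0// => l li.
    by rewrite !mxE eq_sym (negPf li) mul0r.
  by rewrite mulmxBl mul1mx addrC subrK.
have u_ge0 i : 0 <= u i 0.
  by rewrite mxE sumr_ge0// => j _; rewrite mxE mulr1.
have u0 i : 0 < u i 0.
  rewrite pu mxE ltr_wpDl//; last by rewrite mxE.
  by rewrite mxE sumr_ge0// => j _; rewrite mulr_ge0.
have A1 : A [::] = p.
  by apply/matrixP => i j; rewrite mxE /d mass_nil mulr0 addr0 invr1 mul1r.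
have lA i j : laplace (fun t => A t i j).
  have -> : (fun t => A t i j) =
      fun t => p i j * (1 + h 0 i * mass t (x i)) `^ (- 1).
    by apply/funext => t; rewrite mxE powR_inv1 ?(ltW (d0 t i))// mulrC.
  by apply: laplaceZ => //; apply: laplace_gamma => //; exact: ltW.
have [|dA lap] := laplace_det_powRN b0 lA u0.
  by move=> i; rewrite A1 [in ltRHS]pu [ltRHS]mxE ltrDl mxE.
have dp : 0 < \det (1%:M - p) by rewrite -A1.
have dh : 0 < \det (diag_mx h) by rewrite det_diag prodr_gt0.
have detpG : \det (1%:M - p) * \det G = \det (diag_mx h) by rewrite -det_mulmx pG.
have dG : 0 < \det G by rewrite -(pmulr_rgt0 _ dp) detpG.
(* Multiplied on the left by [diag_mx h], which is also [(1%:M - p) *m G], the matrix becomes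
   [diag_mx (\row_i d t i) *m (1%:M - A t) *m G]. The constant comes from [detpG]. *)
have detE t : \det (1%:M + diag_mx (m t) *m G) =
    (\det (1%:M - p))^-1 * (\prod_i d t i * \det (1%:M - A t)).
  apply: (mulfI (lt0r_neq0 dh)).
  rewrite -det_mulmx mulmxDr mulmx1 -{1}pG mulmxA -mulmxDl.
  have -> : 1%:M - p + diag_mx h *m diag_mx (m t) =
      diag_mx (\row_i d t i) *m (1%:M - A t).
    rewrite mulmxBr mulmx1 addrAC; congr (_ - _).
      rewrite mulmx_diag; apply/matrixP => i j; rewrite !mxE /d.
      by case: eqP => [->|_] /=; rewrite ?mulr1n// !mulr0n addr0.
    apply/matrixP => i j; rewrite mul_diag_mx !mxE mulrA mulfV ?mul1r//.
    by rewrite lt0r_neq0.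
  rewrite !det_mulmx -detpG det_diag.
  under eq_bigr do rewrite mxE.
  by field; rewrite lt0r_neq0.
rewrite (_ : (fun t => _) = fun t => ((\det (1%:M - p))^-1) `^ (- b) *
    (\prod_i (d t i) `^ (- b) * \det (1%:M - A t) `^ (- b))); last first.
  apply/funext => t; rewrite detE powRM ?invr_ge0 ?(ltW dp)//; last first.
    by rewrite mulr_ge0 ?(ltW (dA t))// prodr_ge0// => i _; rewrite ltW.
  rewrite powRM ?(ltW (dA t))//; last by rewrite prodr_ge0// => i _; rewrite ltW.
  by rewrite powR_prod// => i; rewrite ltW.
apply: laplaceZ; first exact: powR_ge0.
apply: laplaceM => //; apply: laplace_prod => i.
by apply: laplace_gamma => //; exact: ltW.
Qed.

(** Sylvester's identity, from two triangular factorisations of the block matrix with rows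
    [(1, - A)] and [(B, 1)]. *)
Lemma det_1DmulmxC (F : comNzRingType) (m n : nat) (A : 'M[F]_(m, n)) (B : 'M[F]_(n, m)) :
  \det (1%:M + A *m B) = \det (1%:M + B *m A).
Proof.
have e1 : block_mx 1%:M (- A) B 1%:M =
    block_mx (1%:M + A *m B) (- A) 0 1%:M *m block_mx 1%:M 0 B 1%:M.
  by rewrite mulmx_block !mulmx1 !mulmx0 !add0r mul1mx mulNmx addrK.
have e2 : block_mx 1%:M (- A) B 1%:M =
    block_mx 1%:M 0 B 1%:M *m block_mx 1%:M (- A) 0 (1%:M + B *m A).
  rewrite mulmx_block !mulmx1 !mulmx0 !mul1mx !mul0mx !addr0.
  by rewrite mulmxN [1%:M + _]addrC addKr.
have := congr1 determinant e1; rewrite e2 !det_mulmx !det_ublock !det_lblock.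
by rewrite !det1 !mul1r !mulr1 => ->.
Qed.

(** Reduces repeated points to distinct ones, and allows extra points of weight 0. With the
    incidence matrix [P] of [f], the aggregated weights are [P^T *m diag_mx a *m P] and the Green
    matrix along [x] is [P *m G *m P^T]; Sylvester's identity moves [P^T] across. *)
Lemma det_green_reindex (E : eqType) (g : E -> E -> R) (n k : nat) (a : 'rV[R]_n)
    (x : 'I_n -> E) (y : 'I_k -> E) (f : 'I_n -> 'I_k) :
  injective y -> (forall i, x i = y (f i)) ->
  \det (1%:M + diag_mx (\row_j \sum_i if `[< x i = y j >] then a 0 i else 0) *m
    \matrix_(i < k, j < k) g (y i) (y j)) =
  \det (1%:M + diag_mx a *m \matrix_(i < n, j < n) g (x i) (x j)).
Proof.
move=> injy xy; pose P : 'M[R]_(n, k) := \matrix_(i, j) (f i == j)%:R.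
have xyP i j : `[< x i = y j >] = (f i == j).
  by rewrite xy; apply/asboolP/eqP => [/injy|->].
have -> : diag_mx (\row_j \sum_i if `[< x i = y j >] then a 0 i else 0) =
    P^T *m (diag_mx a *m P).
  apply/matrixP => i j; rewrite !mxE.
  have [<-{j}|ij] := eqVneq i j.
    rewrite mulr1n; apply: eq_bigr => l _; rewrite xyP mul_diag_mx !mxE.
    by case: eqP => _; rewrite ?mul0r// mul1r mulr1.
  rewrite mulr0n big1// => l _; rewrite mul_diag_mx !mxE.
  by case: eqP => [->|_]; rewrite ?mul0r// (negPf ij) mulr0 mulr0.
rewrite -mulmxA det_1DmulmxC; congr (\det (_ + _)).
rewrite -!mulmxA; congr (_ *m _).
apply/matrixP => i j; rewrite [RHS]mxE !xy mxE.
rewrite (bigD1 (f i))//= mxE eqxx mul1r big1 => [|l li]; last first.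
  by rewrite mxE eq_sym (negPf li) mul0r.
rewrite addr0 mxE (bigD1 (f j))//= !mxE eqxx mulr1 big1 ?addr0// => l lj.
by rewrite !mxE eq_sym (negPf lj) mulr0.
Qed.

Lemma mass_map (E : Type) (n : nat) (c : 'I_n -> {nonneg R}) (x : 'I_n -> E) (e : E) :
  mass [seq (x i, c i) | i <- enum 'I_n] e =
  \sum_i if `[< x i = e >] then (c i)%:num else 0.
Proof. by rewrite /mass big_map big_enum. Qed.

Lemma laplace_permanental (E : eqType) (b : R) (g : E -> E -> R) : 0 <= b ->
  (forall u v, 0 <= g u v) ->
  (forall (k : nat) (y : 'I_k -> E), injective y ->
    exists (p : 'M[R]_k) (h : 'rV[R]_k),
      [/\ forall i j, 0 <= p i j, forall i, 0 < h 0 i &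
      (1%:M - p) *m (\matrix_(i < k, j < k) g (y i) (y j)) = diag_mx h]) ->
  exists2 L : ((E -> {nonneg R}) -> R) -> R, positive_functional L &
  forall (n : nat) (a : 'rV[R]_n) (x : 'I_n -> E), (forall i, 0 <= a 0 i) ->
    L (fun v => expR (- \sum_i a 0 i * (v (x i))%:num)) =
    \det (1%:M + diag_mx a *m \matrix_(i < n, j < n) g (x i) (x j)) `^ (- b).
Proof.
move=> b0 g0 ph.
pose y (s : seq E) := tnth (in_tuple (undup s)).
have injy s : injective (y s) by apply/tuple_uniqP; exact: undup_uniq.
pose phi (s : seq E) (t : @test R E) := \det (1%:M +
  diag_mx (\row_j mass t (y s j)) *m \matrix_(i, j) g (y s i) (y s j)) `^ (- b).
have lphi s : laplace (phi s).
  have [p [h [p0 h0 phG]]] := ph _ _ (injy s).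
  rewrite /phi; apply: (@laplace_det_green E b _ (y s) _ p h b0 p0 h0 _ phG) => i j.
  by rewrite mxE.
(* The filter of finite subsets of [E] growing by inclusion, a subset being listed by a sequence. *)
pose F : set_system (seq E) :=
  filter_from setT (fun s0 : seq E => [set s : seq E | {subset s0 <= s}]).
have FF : ProperFilter F.
  apply: filter_from_proper; last by move=> s _; exists s.
  apply: filter_from_filter; first by exists [::].
  move=> s1 s2 _ _; exists (s1 ++ s2) => // s ss; split=> e es; apply: ss.
    by rewrite mem_cat es.
  by rewrite mem_cat es orbT.
(* Consistency: once [s] contains all points of the test, [phi s] no longer depends on [s], so the
   limit along [F] is that of an eventually constant net. *)
have phiE n (a : 'rV[R]_n) (x : 'I_n -> E) (c : 'I_n -> {nonneg R}) :
    (forall i, a 0 i = (c i)%:num) ->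
    \forall s \near F, phi s [seq (x i, c i) | i <- enum 'I_n] =
    \det (1%:M + diag_mx a *m \matrix_(i < n, j < n) g (x i) (x j)) `^ (- b).
  move=> ac; exists (codom x) => // s /= xs.
  have /fin_all_exists[f xf] (i : 'I_n) : exists j, x i = y s j.
    by apply/tnthP; rewrite memtE/= mem_undup; apply: xs; exact: codom_f.
  rewrite /phi -(det_green_reindex g a (injy s) xf); congr (\det (_ + diag_mx _ *m _) `^ _).
  apply/rowP => j; rewrite !mxE mass_map; apply: eq_bigr => i _.
  by rewrite ac.
have Etest t : exists n (a : 'rV[R]_n) (x : 'I_n -> E) (c : 'I_n -> {nonneg R}),
    (forall i, a 0 i = (c i)%:num) /\ t = [seq (x i, c i) | i <- enum 'I_n].
  exists (size t), (\row_i (tnth (in_tuple t) i).2%:num),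
    (fun i => (tnth (in_tuple t) i).1), (fun i => (tnth (in_tuple t) i).2).
  split=> [i|]; first by rewrite mxE.
  rewrite -[LHS]/(tval (in_tuple t)) -[in LHS](map_tnth_enum (in_tuple t)).
  by apply: eq_map => i; rewrite -surjective_pairing.
have /choice[psi psiP] : forall t, exists r : R, \forall s \near F, phi s t = r.
  move=> t; have [n [a [x [c [ac ->]]]]] := Etest t; eexists; exact: phiE.
have [|L pL Lpsi] := @laplace_cvg _ _ _ F FF phi psi lphi.
  move=> t; apply: cvg_near_cst; exact: psiP.
exists L => // n a x a0; pose c i := NngNum (a0 i).
have ac i : a 0 i = (c i)%:num by [].
pose t := [seq (x i, c i) | i <- enum 'I_n].
have -> : (fun v : E -> {nonneg R} => expR (- \sum_i a 0 i * (v (x i))%:num)) =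
    fun v => expR (- pairing t v).
  by apply/funext => v; rewrite /pairing big_map big_enum.
rewrite Lpsi.
have [s [<- <-]] := @filter_ex _ _ FF _ (filterI (psiP t) (phiE n a x c ac)).
by [].
Qed.

End laplace_green.

(** * From positive functionals to random fields *)

Definition cube (I : choiceType) : Type := prod_topology (fun _ : I => bool).
HB.instance Definition _ (I : choiceType) := Pointed.on (cube I).
HB.instance Definition _ (I : choiceType) := Topological.on (cube I).

Lemma clopen_setC (T : topologicalType) (A : set T) : clopen A -> clopen (~` A).
Proof. exact: clopenC. Qed.

(** From here on, measurable in [cube I] means clopen; the generated sigma-algebra is carried by
    [g_sigma_algebraType]. *)
HB.instance Definition _ (I : choiceType) :=
  isAlgebraOfSets.Build default_measure_display (cube I)
    (@clopen0 (cube I)) (@clopenU (cube I)) (@clopen_setC (cube I)).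

Section cube.
Context {I : choiceType}.
Implicit Types (A : set (cube I)).

Lemma clopen_coordinate (i : I) (b : bool) : clopen [set w : cube I | w i = b].
Proof.
rewrite (_ : [set _ | _] = (@proj I (fun=> bool) i) @^-1` [set b])//.
apply: preimage_clopen; last exact: proj_continuous.
by split; [exact: discrete_open|exact: discrete_closed].
Qed.

Lemma cube_compact : compact [set: cube I].
Proof.
rewrite (_ : setT = [set f : cube I | forall i, [set: bool] (f i)]).
  exact: (@tychonoff I (fun=> bool) (fun=> setT) (fun=> bool_compact)).
by apply/seteqP; split.
Qed.

(** A clopen set is closed in a compact space, and the cover is open. Countable subadditivity of a
    content on clopen sets thus reduces to the finite one. *)
Lemma clopen_finite_subcover A (F : nat -> set (cube I)) :
  clopen A -> (forall n, clopen (F n)) -> A `<=` \bigcup_n F n ->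
  exists N, A `<=` \big[setU/set0]_(n < N) F n.
Proof.
move=> [_ cA] cF AF.
have : compact A by apply: (subclosed_compact cA cube_compact).
rewrite compact_cover => /(_ nat setT F) [|//|D' _ AD'].
  by move=> n _; case: (cF n).
exists (\max_(n <- finmap.enum_fset D') n).+1 => w /AD'[n /= nD' Fnw].
rewrite -bigcup_mkord; exists n => //=.
by rewrite ltnS; apply: (@leq_bigmax_seq _ _ _ (fun n => n)).
Qed.

End cube.

Section clopen_content.
Context {R : realType} {I : choiceType}.
Variables (L : (cube I -> R) -> R) (pL : positive_functional L).

(** The proof of positivity is an argument so that the content and measure structures can be
    attached to the term. *)
Definition clopen_content of positive_functional L :=
  fun A : set (cube I) => (L \1_A)%:E.
Local Notation mu := (clopen_content pL).

Lemma bounded_real_indic (T : Type) (A : set T) : bounded_real (\1_A : T -> R).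
Proof. by exists 1 => w; rewrite indicE; case: (_ \in _); rewrite ?normr1 ?normr0. Qed.

Let mu_ge0 A : (0 <= mu A)%E.
Proof. by rewrite lee_fin; apply: (pf_ge0 pL) => //; exact: bounded_real_indic. Qed.

Let mu_semi_additive : measure_function.semi_additive mu.
Proof.
have mu0 : mu set0 = 0%E by rewrite /clopen_content indic0 (pf0 pL).
apply/(additive2P mu0).
move=> A B _ _ AB0; rewrite /clopen_content -EFinD -(pfD pL); [|exact: bounded_real_indic..].
congr ((L _)%:E); apply/funext => w.
rewrite !indicE in_setU; case: (boolP (w \in A)) => wA; case: (boolP (w \in B)) => wB;
  rewrite ?addr0 ?add0r//.
by have : set0 w by rewrite -AB0; split; exact: set_mem.
Qed.

HB.instance Definition _ := isContent.Build _ _ _ mu mu_ge0 mu_semi_additive.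

Let mu_sigma_subadditive : measurable_subset_sigma_subadditive mu.
Proof.
move=> A F mF mA AF; have [N AN] := clopen_finite_subcover mA mF AF.
apply: (@le_trans _ _ (\sum_(0 <= n < N) mu (F n))%E); last first.
  exact: nneseries_lim_ge.
rewrite big_mkord; by apply: content_subadditive => // k _; exact: mF.
Qed.

HB.instance Definition _ :=
  Content_SigmaSubAdditive_isMeasure.Build _ _ _ mu mu_sigma_subadditive.

End clopen_content.

(** * Binary expansions *)

Section binary_expansion.
Context {R : realType}.
Implicit Types (t : R) (w : nat -> bool).

(** The orbit of [t] under the doubling map. It stays in the closed unit interval; all digits of 1
    are ones. *)
Fixpoint remainder t (k : nat) : R := if k is k'.+1 then
  2 * remainder t k' - (2^-1 <= remainder t k')%R%:R else t.

Definition digit t (k : nat) : bool := 2^-1 <= remainder t k.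

Definition dyadic w (K : nat) : R := \sum_(k < K) (w k)%:R * 2^-1 ^+ k.+1.

Definition binary_value w : R := limn (dyadic w).

Lemma remainder_itv t k : 0 <= t <= 1 -> 0 <= remainder t k <= 1.
Proof.
move=> t01; elim: k => [//|k /= /andP[]].
by case: (leP 2^-1 (remainder t k)) => /=; lra.
Qed.

Lemma digitE t K : t = dyadic (digit t) K + 2^-1 ^+ K * remainder t K.
Proof.
elim: K => [|K IH]; first by rewrite /dyadic big_ord0 add0r expr0 mul1r.
rewrite /dyadic big_ord_recr/= -/(dyadic _ _) {1}IH -/(digit t K) exprS.
by field.
Qed.

Lemma dyadic_digit_bounds t K : 0 <= t <= 1 ->
  dyadic (digit t) K <= t <= dyadic (digit t) K + 2^-1 ^+ K.
Proof.
move=> t01; have /andP[r0 r1] := remainder_itv K t01.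
have h0 : 0 <= 2^-1 ^+ K :> R by rewrite exprn_ge0.
rewrite {2 3}(digitE t K) lerDl mulr_ge0//= lerD2l.
by rewrite -[leRHS]mulr1 ler_wpM2l.
Qed.

Lemma dyadic_ge0 w K : 0 <= dyadic w K.
Proof. by apply: sumr_ge0 => k _; rewrite mulr_ge0. Qed.

Lemma dyadic_homo w : {homo dyadic w : m n / (m <= n)%N >-> m <= n}.
Proof.
apply/nondecreasing_seqP => K; rewrite /dyadic big_ord_recr/= lerDl mulr_ge0//.
Qed.

(** A new digit adds at most half of the current gap. Upper and lower sums therefore bracket the
    value of any digit sequence. *)
Lemma dyadic_upper_antihomo w :
  {homo (fun K => dyadic w K + 2^-1 ^+ K) : m n / (m <= n)%N >-> n <= m}.
Proof.
apply/nonincreasing_seqP => K; rewrite /dyadic big_ord_recr/= -addrA lerD2l exprS.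
have h0 : 0 <= 2^-1 ^+ K :> R by rewrite exprn_ge0.
by case: (w K) => /=; lra.
Qed.

Lemma is_cvg_dyadic w : cvgn (dyadic w).
Proof.
apply: nondecreasing_is_cvgn; first exact: dyadic_homo.
exists 1 => _ [K _ <-]; have := dyadic_upper_antihomo w (leq0n K).
rewrite /= {2}/dyadic big_ord0 add0r expr0; apply: le_trans.
by rewrite lerDl exprn_ge0.
Qed.

Lemma dyadic_bounds w K :
  dyadic w K <= binary_value w <= dyadic w K + 2^-1 ^+ K.
Proof.
apply/andP; split; first by apply: nondecreasing_cvgn_le; [exact: dyadic_homo|exact: is_cvg_dyadic].
apply: limr_le; first exact: is_cvg_dyadic.
near=> n; apply: le_trans (dyadic_upper_antihomo w (_ : (K <= n)%N)).
  by rewrite lerDl exprn_ge0.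
by near: n; exact: nbhs_infty_ge.
Unshelve. all: by end_near. Qed.

Lemma binary_value_itv w : 0 <= binary_value w <= 1.
Proof.
by have := dyadic_bounds w 0; rewrite /dyadic big_ord0 expr0 add0r.
Qed.

Lemma cvg_dyadic w : dyadic w K @[K --> \oo] --> binary_value w.
Proof. exact: is_cvg_dyadic. Qed.

Lemma cvg_dyadic_upper w : dyadic w K + 2^-1 ^+ K @[K --> \oo] --> binary_value w.
Proof.
rewrite -[X in _ --> X]addr0; apply: cvgD; first exact: cvg_dyadic.
have -> : GRing.exp (2^-1 : R) = geometric 1 2^-1 by apply/funext => n; rewrite /= mul1r.
by apply: cvg_geometric; rewrite ger0_norm// invf_lt1// ltr1n.
Qed.

Lemma cvg_powR_ge0 (u : nat -> R) (l a : R) : 0 <= a -> (forall n, 0 <= u n) ->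
  u n @[n --> \oo] --> l -> (u n) `^ a @[n --> \oo] --> l `^ a.
Proof.
move=> a0 u0 ul; have [->|a_neq0] := eqVneq a 0.
  by under eq_fun do rewrite powRr0; rewrite powRr0; exact: cvg_cst.
have {a_neq0}a0 : 0 < a by rewrite lt_neqAle eq_sym a_neq0.
have l0 : 0 <= l.
  by rewrite -(cvg_lim _ ul)//; apply: limr_ge; [exact: cvgP ul|exact: nearW].
have [l00|l_neq0] := eqVneq l 0; last first.
  apply: (@continuous_cvg _ _ _ _ _ _ (@powR R ^~ a) _ _ ul).
  by apply: continuous_powR_base; rewrite lt_neqAle eq_sym l_neq0.
(* At base 0 the limit is checked by hand: the power is below [e] once the base is below the power
   [a^-1] of [e]. *)
rewrite l00 powR0 ?gt_eqF//; apply/cvgr0Pnorm_lt => e e0.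
near=> n; rewrite ger0_norm ?powR_ge0//.
have -> : e = (e `^ a^-1) `^ a by rewrite -powRrM mulVf ?gt_eqF// powRr1// ltW.
apply: gt0_ltr_powR => //; rewrite ?nnegrE// ?powR_ge0//.
near: n; apply: (cvgr_lt l ul); rewrite l00; exact: powR_gt0.
Unshelve. all: by end_near. Qed.

Lemma cvg_prodr (T : Type) (s : seq T) (u : T -> nat -> R) (l : T -> R) :
  (forall i, u i n @[n --> \oo] --> l i) ->
  \prod_(i <- s) u i n @[n --> \oo] --> \prod_(i <- s) l i.
Proof.
move=> ul; elim: s => [|i s IH].
  by under eq_fun do rewrite big_nil; rewrite big_nil; exact: cvg_cst.
by under eq_fun do rewrite big_cons; rewrite big_cons; exact: cvgM.
Qed.

End binary_expansion.

(** * The probability measure on the cube *)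

Section cube_measure.
Context {R : realType} {I : choiceType}.
Variables (L : (cube I -> R) -> R) (pL : positive_functional L).
Hypothesis L1 : L (fun=> 1) = 1.

Definition cube_measure of L (fun=> 1) = 1 := measure_extension (clopen_content pL).
Local Notation P := (cube_measure L1).
Local Notation T := (g_sigma_algebraType (@clopen (cube I))).

HB.instance Definition _ := Measure.on P.

Lemma cube_measureE (A : set (cube I)) : clopen A -> P A = (L \1_A)%:E.
Proof. by move=> cA; rewrite /cube_measure /measure_extension measurable_mu_extE. Qed.

Let P1 : P setT = 1%E.
Proof.
by rewrite cube_measureE; [rewrite indicT L1|exact: clopenT].
Qed.

HB.instance Definition _ := Measure_isProbability.Build _ _ _ P P1.

Lemma clopen_cylinder (J : finType) (c : J -> I) (p : {ffun J -> bool}) :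
  clopen [set w : cube I | forall j, w (c j) = p j].
Proof.
have -> : [set w : cube I | forall j, w (c j) = p j] =
    \big[setI/setT]_(j <- enum J) [set w : cube I | w (c j) = p j].
  rewrite -bigcap_seq; apply/seteqP; split => w /= wp j; first by move=> _; exact: wp.
  by apply: wp; rewrite /= mem_enum.
elim/big_ind : _ => [|A B cA cB|j _]; first exact: clopenT.
  exact: clopenI.
exact: clopen_coordinate.
Qed.

(** A function of finitely many coordinates is a finite combination of indicators of clopen
    cylinders, where the measure and [L] agree. *)
Lemma integral_cylinder (J : finType) (c : J -> I) (G : {ffun J -> bool} -> R) :
  (forall p, 0 <= G p) ->
  (\int[P]_w (G [ffun j => w (c j)])%:E = (L (fun w => G [ffun j => w (c j)]))%:E)%E.
Proof.
move=> G0; pose cyl (p : {ffun J -> bool}) := [set w : cube I | forall j, w (c j) = p j].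
have GE w : G [ffun j => w (c j)] = \sum_p G p * \1_(cyl p) w.
  rewrite (bigD1 [ffun j => w (c j)])//= indicE mem_set/=; last first.
    by move=> j; rewrite ffunE.
  rewrite mulr1 big1 ?addr0// => p pw; rewrite indicE memNset ?mulr0//= => wp.
  by case/eqP: pw; apply/ffunP => j; rewrite ffunE.
have mcyl p : measurable (cyl p : set T).
  by apply: sub_sigma_algebra; exact: clopen_cylinder.
transitivity (\int[P]_w \sum_(p <- enum {ffun J -> bool}) (G p * \1_(cyl p) w)%:E)%E.
  apply: eq_integral => w _; by rewrite GE -sumEFin big_enum.
rewrite ge0_integral_sum//=; last 2 first.
- by move=> p; apply/measurable_EFinP; apply: measurable_funM => //; exact: measurable_indic.
- by move=> p w _; rewrite lee_fin mulr_ge0.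
have -> : (fun w : cube I => G [ffun j => w (c j)]) =
    fun w => \sum_(p <- enum {ffun J -> bool}) G p * \1_(cyl p) w.
  by apply/funext => w; rewrite GE big_enum.
rewrite (pf_sum pL); last by move=> p; apply: bounded_realZ; exact: bounded_real_indic.
rewrite -sumEFin; apply: eq_bigr => p _.
under eq_integral do rewrite EFinM.
rewrite ge0_integralZl ?lee_fin//; last first.
  by apply/measurable_EFinP; exact: measurable_indic.
rewrite integral_indic// setIT (pfZ pL); last exact: bounded_real_indic.
rewrite EFinM; congr (_ * _)%E.
exact: (cube_measureE (clopen_cylinder c p)).
Qed.

End cube_measure.

(** * The random field *)

Section random_field.
Context {R : realType} {E : choiceType}.
Local Notation V := (E -> {nonneg R}).
Variables (L : (V -> R) -> R) (pL : positive_functional L).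
Hypothesis L1 : L (fun=> 1) = 1.
(* No mass escapes to infinity at [x]. *)
Hypothesis tightL : forall x (e : R), 0 < e ->
  exists2 a, 0 < a & 1 - e < L (fun v => expR (- (a * (v x)%:num))).

(** The exponential maps the half-line into the unit interval, where digits are available; infinity
    corresponds to the value 0. *)
Let encode (v : V) : cube (E * nat)%type :=
  fun p => digit (expR (- (v p.1)%:num)) p.2.

Let L' (f : cube (E * nat)%type -> R) := L (f \o encode).

Let pL' : positive_functional L'.
Proof.
have be f : bounded_real f -> bounded_real (f \o encode).
  by move=> [C fC]; exists C => v; exact: fC.
split=> [f g bf bg|a f bf|f bf f0].
- by rewrite -(pfD pL)//; exact: be.
- by rewrite -(pfZ pL)//; exact: be.
- by apply: (pf_ge0 pL); [exact: be|move=> v; exact: f0].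
Qed.

Let P := cube_measure pL' L1.
Let T := g_sigma_algebraType (@clopen (cube (E * nat)%type)).

Let value (x : E) (w : T) : R := binary_value (fun k => w (x, k)).

Let measurable_coordinate p : measurable_fun setT (fun w : T => (w p)%:R : R).
Proof.
rewrite (_ : (fun _ => _) = \1_([set w : T | w p = true])); last first.
  by apply/funext => w; rewrite indicE; congr ((_ : bool)%:R); apply/idP/idP; rewrite inE.
by apply: measurable_indic; apply: sub_sigma_algebra; exact: clopen_coordinate.
Qed.

Let measurable_dyadic x K : measurable_fun setT (fun w : T => dyadic (fun k => w (x, k)) K : R).
Proof. by apply: measurable_sum => k; apply: measurable_funM. Qed.

Let measurable_value x : measurable_fun setT (value x).
Proof.
apply: (@measurable_fun_cvg _ T R setT
    (fun K w => dyadic (fun k => w (x, k)) K : R) (value x)).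
  exact: measurable_dyadic.
by move=> w _; exact: cvg_dyadic.
Qed.

Let value_itv x w : 0 <= value x w <= 1.
Proof. exact: binary_value_itv. Qed.

(** [L] need not commute with limits, so the digits are truncated: [lo K] and [up K] depend on
    finitely many digits, and for them [integral_cylinder] is exact. Their integrals bracket [L chi]
    and, by dominated convergence, have the integral of the product as common limit. *)
Lemma integral_prod_value (n : nat) (a : 'I_n -> R) (x : 'I_n -> E) :
  (forall i, 0 <= a i) ->
  (\int[P]_w (\prod_i value (x i) w `^ a i)%:E =
   (L (fun v => expR (- \sum_i a i * (v (x i))%:num)))%:E)%E.
Proof.
move=> a0.
pose lo K (w : T) : R := \prod_i dyadic (fun k => w (x i, k)) K `^ a i.
pose up K (w : T) : R := \prod_i (dyadic (fun k => w (x i, k)) K + 2^-1 ^+ K) `^ a i.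
pose chi (v : V) : R := expR (- \sum_i a i * (v (x i))%:num).
have h0 K : 0 <= 2^-1 ^+ K :> R by rewrite exprn_ge0.
pose D K i (p : {ffun 'I_n * 'I_K -> bool}) : R :=
  \sum_(k < K) (p (i, k))%:R * 2^-1 ^+ k.+1.
have D0 K i p : 0 <= D K i p by apply: sumr_ge0 => k _; rewrite mulr_ge0.
pose c K (j : 'I_n * 'I_K) : E * nat := (x j.1, j.2 : nat).
have DE K i (w : T) : D K i [ffun j => w (c K j)] = dyadic (fun k => w (x i, k)) K.
  by apply: eq_bigr => k _; rewrite ffunE.
have int_lo K : (\int[P]_w (lo K w)%:E = (L (lo K \o encode))%:E)%E.
  have := integral_cylinder pL' L1 (c K) (G := fun p => \prod_i D K i p `^ a i).
  under eq_integral do under eq_bigr do rewrite DE.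
  move=> ->; last by move=> p; apply: prodr_ge0 => i _; exact: powR_ge0.
  by congr ((L _)%:E); apply/funext => v /=; apply: eq_bigr => i _; rewrite DE.
have int_up K : (\int[P]_w (up K w)%:E = (L (up K \o encode))%:E)%E.
  have := integral_cylinder pL' L1 (c K)
    (G := fun p => \prod_i (D K i p + 2^-1 ^+ K) `^ a i).
  under eq_integral do under eq_bigr do rewrite DE.
  move=> ->; last by move=> p; apply: prodr_ge0 => i _; exact: powR_ge0.
  by congr ((L _)%:E); apply/funext => v /=; apply: eq_bigr => i _; rewrite DE.
have chiE v : chi v = \prod_i expR (- (v (x i))%:num) `^ a i.
  rewrite /chi -sumrN expR_sum; apply: eq_bigr => i _.
  by rewrite -mulrN mulrC expRM.
have dy_le1 (w : nat -> bool) K : dyadic w K <= 1 :> R.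
  have /andP[d1 _] := @dyadic_bounds R w K.
  by have /andP[_ v1] := @binary_value_itv R w; exact: le_trans d1 v1.
have h1 K : 2^-1 ^+ K <= 1 :> R by rewrite exprn_ile1// invf_le1// ler1n.
pose C := \prod_i (2 : R) `^ a i.
have up_le K w : up K w <= C.
  apply: ler_prod => i _; rewrite powR_ge0/=.
  apply: ge0_ler_powR; rewrite ?nnegrE ?addr_ge0 ?dyadic_ge0//.
  by rewrite -[2]/(1 + 1) lerD.
have lo_le_up K w : lo K w <= up K w.
  apply: ler_prod => i _; rewrite powR_ge0/=.
  by apply: ge0_ler_powR; rewrite ?nnegrE ?addr_ge0 ?dyadic_ge0// lerDl.
have lo_ge0 K w : 0 <= lo K w by apply: prodr_ge0 => i _; exact: powR_ge0.
have up_ge0 K w : 0 <= up K w by apply: prodr_ge0 => i _; exact: powR_ge0.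
have exp01 (v : V) i : 0 <= expR (- (v (x i))%:num) <= 1.
  by rewrite expR_ge0/= expR_le1 oppr_le0.
have lo_chi K v : lo K (encode v) <= chi v.
  rewrite chiE; apply: ler_prod => i _; rewrite powR_ge0/=.
  apply: ge0_ler_powR; rewrite ?nnegrE ?dyadic_ge0 ?expR_ge0//.
  by have /andP[] := dyadic_digit_bounds K (exp01 v i).
have chi_up K v : chi v <= up K (encode v).
  rewrite chiE; apply: ler_prod => i _; rewrite powR_ge0/=.
  apply: ge0_ler_powR; rewrite ?nnegrE ?addr_ge0 ?dyadic_ge0 ?expR_ge0//.
  by have /andP[] := dyadic_digit_bounds K (exp01 v i).
have b_lo K : bounded_real (lo K \o encode).
  by exists C => v /=; rewrite ger0_norm// (le_trans (lo_le_up _ _)).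
have b_up K : bounded_real (up K \o encode).
  by exists C => v /=; rewrite ger0_norm.
have b_chi : bounded_real chi.
  exists C => v; rewrite ger0_norm ?expR_ge0//.
  exact: le_trans (chi_up 0%N v) (up_le 0%N _).
have m_lo K : measurable_fun setT (EFin \o lo K).
  apply/measurable_EFinP; apply: measurable_prod => i _.
  by apply: (measurableT_comp (measurable_powR _)).
have m_up K : measurable_fun setT (EFin \o up K).
  apply/measurable_EFinP; apply: measurable_prod => i _.
  by apply: (measurableT_comp (measurable_powR _)); apply: measurable_funD.
have iC : P.-integrable setT (EFin \o cst C) by exact: finite_measure_integrable_cst.
have cv_lo : (\int[P]_w (lo K w)%:E @[K --> \oo] -->
    \int[P]_w (\prod_i value (x i) w `^ a i)%:E)%E.
  apply: (dominated_cvg _ m_lo _ _ iC) => // [w _|K w _].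
    apply: cvg_EFin; first exact: nearW.
    apply: cvg_prodr => i; apply: cvg_powR_ge0 => //; last exact: cvg_dyadic.
    by move=> K; exact: dyadic_ge0.
  by rewrite lee_fin ger0_norm// (le_trans (lo_le_up _ _)).
have cv_up : (\int[P]_w (up K w)%:E @[K --> \oo] -->
    \int[P]_w (\prod_i value (x i) w `^ a i)%:E)%E.
  apply: (dominated_cvg _ m_up _ _ iC) => // [w _|K w _].
    apply: cvg_EFin; first exact: nearW.
    apply: cvg_prodr => i; apply: cvg_powR_ge0 => //; last exact: cvg_dyadic_upper.
    by move=> K; rewrite addr_ge0// dyadic_ge0.
  by rewrite lee_fin ger0_norm.
apply/eqP; rewrite eq_le; apply/andP; split.
- rewrite -(cvg_lim _ cv_lo)//; apply: lime_le; first exact: cvgP cv_lo.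
  by apply: nearW => K; rewrite int_lo lee_fin; apply: (pf_le pL) => // v; exact: lo_chi.
- rewrite -(cvg_lim _ cv_up)//; apply: lime_ge; first exact: cvgP cv_up.
  by apply: nearW => K; rewrite int_up lee_fin; apply: (pf_le pL) => // v; exact: chi_up.
Qed.

(** The value 0 stands for an infinite field. For [a > 0] the power [a] of the value is at most the
    indicator of a nonzero value, so [tightL] gives that event probability at least [1 - e] for
    every [e > 0]. *)
Let negligible_value0 x : P.-negligible [set w | value x w = 0].
Proof.
set N : set T := [set w | value x w = 0].
have mN : measurable N.
  have := measurable_value x measurableT (measurable_set1 0).
  by rewrite setTI.
exists N; split => //.
apply/eqP; rewrite eq_le measure_ge0 andbT; apply/lee_addgt0Pr => e e0.
rewrite add0e; have [a a0 La] := tightL x e0.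
have : ((1 - e)%:E <= P (~` N))%E.
  have -> : P (~` N) = (\int[P]_w (\1_(~` N) w)%:E)%E.
    by rewrite integral_indic ?setIT//; exact: measurableC.
  have := @integral_prod_value 1 (fun=> a) (fun=> x) (fun=> ltW a0).
  under eq_integral do rewrite big_ord1.
  rewrite (_ : (fun v : V => _) = fun v => expR (- (a * (v x)%:num))); last first.
    by apply/funext => v; rewrite big_ord1.
  move=> intE; apply: (@le_trans _ _ (\int[P]_w (value x w `^ a)%:E)%E).
    by rewrite intE lee_fin ltW.
  apply: ge0_le_integral => //.
  - by move=> w _; rewrite lee_fin powR_ge0.
  - apply/measurable_EFinP.
    exact: (measurableT_comp (measurable_powR a) (measurable_value x)).
  - apply/measurable_EFinP; apply: measurable_indic; exact: measurableC.
  - move=> w _; rewrite lee_fin indicE.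
    have [v0|v0] := eqVneq (value x w) (0 : R); first by rewrite v0 powR0 ?gt_eqF// ler0n.
    rewrite mem_set/=; last exact/eqP.
    have /andP[w0 w1] := value_itv x w.
    rewrite (_ : true%:R = 1 `^ a); last by rewrite powR1.
    by apply: ge0_ler_powR; rewrite ?nnegrE ?(ltW a0).
have -> : P (~` N) = (1 - P N)%E by exact: probability_setC.
have : P N \is a fin_num by exact: fin_num_measure.
case: (P _) => [r| |]//= _; rewrite -EFinB !lee_fin; lra.
Qed.

Lemma exists_random_field : exists (d : measure_display) (T' : measurableType d)
    (Q : probability T' R) (psi : E -> {RV Q >-> R}),
  (forall x w, 0 <= psi x w) /\
  forall (n : nat) (a : 'I_n -> R) (x : 'I_n -> E), (forall i, 0 <= a i) ->
  ('E_Q[fun w => expR (- (2^-1) * \sum_(i < n) a i * psi (x i) w)] =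
   (L (fun v => expR (- \sum_i a i * (v (x i))%:num)))%:E)%E.
Proof.
(* The factor 2 cancels the half in the exponent, so that the exponential is the product of powers
   of the values. What [ln] returns at the value 0 only matters on a negligible set. *)
have mpsi x : measurable_fun setT (fun w : T => - 2 * ln (value x w)).
  apply: measurable_funM => //.
  exact: (measurableT_comp (@measurable_ln R) (measurable_value x)).
exists _, T, P.
exists (fun x => mfun_Sub (mem_set (mpsi x : [set f | measurable_fun setT f] _))).
split=> [x w /=|n a x a0].
  by rewrite mulNr -mulrN mulr_ge0// oppr_ge0 ln_le0//; case/andP: (value_itv x w).
rewrite -integral_prod_value// unlock.
have mprod : measurable_fun setT (fun w : T => \prod_i value (x i) w `^ a i).
  apply: measurable_prod => i _.
  exact: (measurableT_comp (measurable_powR (a i)) (measurable_value (x i))).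
apply: ae_eq_integral => //.
- apply/measurable_EFinP; apply: measurableT_comp => //.
  apply: measurable_funM => //; apply: measurable_sum => i.
  by apply: measurable_funM => //; exact: mpsi.
- exact/measurable_EFinP.
have : \forall w \ae P, forall i : 'I_n, value (x i) w <> 0.
  apply: filter_forall => i; have := negligible_value0 (x i).
  by apply: negligibleS => w /= /contrapT.
apply: filterS => w v0 _; congr (_%:E).
rewrite mulr_sumr expR_sum; apply: eq_bigr => i _ /=.
rewrite /powR; case: eqP => [/v0//|_]; congr expR.
by field.
Qed.

End random_field.

(** * Green functions of strong Markov processes *)

Section stopping_times.
Context {R : realType} {d : measure_display} {Omega : measurableType d}.
Variable F : R -> set (set Omega).
Hypothesis filtF : right_continuous_filtration F.
Implicit Types (T : Omega -> \bar R).

(** Makes the closure lemmas for measurable sets available for the members of [F t]. *)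
Lemma filtration_measurableE (t : R) : 0 <= t ->
  @measurable _ (g_sigma_algebraType (F t)) = F t.
Proof. by case: filtF => sF _ _ _ t0; apply: sigma_algebra_id; exact: sF. Qed.

Lemma stopping_time_cst : stopping_time F (fun=> +oo%E).
Proof.
split=> [w|t t0]; first exact: leey.
rewrite -filtration_measurableE// (_ : [set _ | _] = set0); first exact: measurable0.
by apply/seteqP; split.
Qed.

Lemma stopping_time_min T1 T2 : stopping_time F T1 -> stopping_time F T2 ->
  stopping_time F (fun w => Order.min (T1 w) (T2 w)).
Proof.
move=> [T10 mT1] [T20 mT2]; split=> [w|t t0]; first by rewrite le_min T10 T20.
rewrite -filtration_measurableE//.
rewrite (_ : [set _ | _] = [set w | (T1 w <= t%:E)%E] `|` [set w | (T2 w <= t%:E)%E]).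
  by apply: measurableU; rewrite filtration_measurableE//; [exact: mT1|exact: mT2].
by apply/seteqP; split => w /=; rewrite ge_min => /orP.
Qed.

Lemma stopping_time_bigmin (I : Type) (s : seq I) (T : I -> Omega -> \bar R) :
  (forall i, stopping_time F (T i)) ->
  stopping_time F (fun w => \big[Order.min/+oo%E]_(i <- s) T i w).
Proof.
move=> sT; elim: s => [|i s IH].
  by under eq_fun do rewrite big_nil; exact: stopping_time_cst.
by under eq_fun do rewrite big_cons; exact: stopping_time_min.
Qed.

Lemma stopped_sigma_algebraC T A : stopping_time F T ->
  stopped_sigma_algebra F T A -> stopped_sigma_algebra F T (~` A).
Proof.
move=> [_ mT] [mA AT]; split=> [|t t0]; first exact: measurableC.
have -> : ~` A `&` [set w | (T w <= t%:E)%E] =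
    [set w | (T w <= t%:E)%E] `\` (A `&` [set w | (T w <= t%:E)%E]).
  by apply/seteqP; split=> w /=; tauto.
rewrite -filtration_measurableE//; apply: measurableD; rewrite filtration_measurableE//.
  exact: mT.
exact: AT.
Qed.

(* Unlike [first_increase], an infimum over rational times is a stopping time
   without any regularity of the paths outside a null set. *)
Definition rational_increase (A : R -> Omega -> R) (w : Omega) : \bar R :=
  ereal_inf [set (ratr q)%:E | q in [set q : rat | 0 <= q /\ 0 < A (ratr q) w]].

Lemma rational_increase_ge0 A w : (0 <= rational_increase A w)%E.
Proof.
by apply: le_ereal_inf_tmp => _ [q [q0 _] <-]; rewrite lee_fin ler0q.
Qed.

Lemma rational_increase_le A w (q : rat) : 0 <= q -> 0 < A (ratr q) w ->
  (rational_increase A w <= (ratr q)%:E)%E.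
Proof. by move=> q0 Aq; apply: ereal_inf_lbound; exists q. Qed.

Lemma rational_increase_lt A w (r : \bar R) : (rational_increase A w < r)%E ->
  exists q : rat, [/\ 0 <= q, 0 < A (ratr q) w & ((ratr q)%:E < r)%E].
Proof. by move=> /ereal_inf_lt[_ [q [q0 Aq] <-] qr]; exists q. Qed.

Lemma first_increase_le_rational A w : (first_increase A w <= rational_increase A w)%E.
Proof.
apply: le_ereal_inf_tmp => _ [q [q0 Aq] <-]; apply: ereal_inf_lbound.
by exists (ratr q) => //; split=> //; rewrite ler0q.
Qed.

Lemma stopping_time_rational_increase A :
  (forall t (B : set R), 0 <= t -> measurable B -> F t (A t @^-1` B)) ->
  stopping_time F (rational_increase A).
Proof.
move=> mA; split=> [w|t t0]; first exact: rational_increase_ge0.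
have [sF _ hF rF] := filtF; apply: rF => // s ts.
have s0 : 0 <= s by rewrite (le_trans t0)// ltW.
(* [r n] decreases from [s] to [t]: every rational time involved is below [s], so the event is in
   [F s]. As [s > t] is arbitrary, right continuity puts it in [F t]. *)
pose r n := t + (s - t) / n.+1%:R.
pose C n (q : rat) : set Omega :=
  [set w | [/\ 0 <= q, (ratr q < r n) & 0 < A (ratr q) w]].
have -> : [set w | (rational_increase A w <= t%:E)%E] = \bigcap_n \bigcup_q C n q.
  apply/seteqP; split=> w /=.
    move=> Tt n _; have : (rational_increase A w < (r n)%:E)%E.
      by rewrite (le_lt_trans Tt)// lte_fin ltrDl divr_gt0// subr_gt0.
    by move=> /rational_increase_lt[q [q0 Aq]]; rewrite lte_fin => qr; exists q.
  move=> Cw; apply/lee_addgt0Pr => e e0.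
  have st0 : 0 < s - t by rewrite subr_gt0.
  have [n] := ltr_add_invr (divr_gt0 e0 st0).
  rewrite add0r ltr_pdivlMr// => ne.
  have [q _ [q0 qr Aq]] := Cw n I.
  apply: (le_trans (rational_increase_le q0 Aq)); rewrite -EFinD lee_fin.
  by rewrite ltW// (lt_trans qr)// /r ltrD2l mulrC.
rewrite -filtration_measurableE//; apply: bigcapT_measurable => n.
apply: bigcupT_measurable_rat => q.
have [q0|q0] := leP 0 q; last first.
  rewrite (_ : C n q = set0); first exact: measurable0.
  by apply/seteqP; split=> // w [q0']; rewrite leNgt q0 in q0'.
have [qr|qr] := ltP (ratr q) (r n); last first.
  rewrite (_ : C n q = set0); first exact: measurable0.
  by apply/seteqP; split=> // w [_ qr']; rewrite ltNge qr in qr'.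
rewrite (_ : C n q = A (ratr q) @^-1` `]0, +oo[).
  rewrite filtration_measurableE//; apply: (hF (ratr q)); first by rewrite ler0q.
    rewrite (le_trans (ltW qr))// /r -lerBrDl ler_pdivrMr// ler_peMr ?ler1n//.
    by rewrite subr_ge0 ltW.
  by apply: mA; [rewrite ler0q|exact: measurable_itv].
by apply/seteqP; split=> w /=; rewrite in_itv/= andbT => // -[].
Qed.

End stopping_times.

Lemma bigmin_pinfty (R : realType) (I : eqType) (s : seq I) (T : I -> \bar R) :
  let m := \big[Order.min/+oo%E]_(i <- s) T i in
  (forall i, i \in s -> (m <= T i)%E) /\
  (m = +oo%E \/ exists2 i, i \in s & m = T i).
Proof.
elim: s => [|i s [IH1 IH2]] /=; first by rewrite big_nil; split=> //; left.
rewrite big_cons; split.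
  move=> j; rewrite inE => /orP[/eqP ->|js]; first by rewrite ge_min lexx.
  by rewrite ge_min IH1// orbT.
have [Ti|Ti] := leP (T i) (\big[Order.min/+oo%E]_(j <- s) T j).
  by right; exists i => //; rewrite inE eqxx.
case: IH2 => [->|[j js ->]]; first by left.
by right; exists j => //; rewrite inE js orbT.
Qed.

(** * Paths of continuous additive functionals *)

Section regular_paths.
Context {R : realType} {dE dO : measure_display}.
Context {E : measurableType dE} {Omega : measurableType dO}.
Variable M : strong_markov_process R E Omega.

Definition total (A : R -> Omega -> R) (w : Omega) : \bar R :=
  ereal_sup (range (fun n : nat => (A n%:R w)%:E)).

(** The almost sure conditions on a continuous additive functional, gathered on one path so that the
    arguments below are deterministic. *)
Definition regular_path (A : R -> Omega -> R) (w : Omega) :=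
  [/\ A 0 w = 0,
      forall s t, 0 <= s -> s <= t -> A s w <= A t w,
      {within `[0, +oo[, continuous (A ^~ w)},
      forall s t, 0 <= s -> s <= t -> Defs.coord M s w = None -> A t w = A s w &
      forall s t, 0 <= s -> 0 <= t -> A (t + s) w = A t w + A s (Defs.shift M t w)].

Lemma ae_regular_path (A : R -> Omega -> R) (x : E) :
  continuous_additive_functional M A -> {ae Defs.law M x, forall w, regular_path A w}.
Proof.
case=> _ /(_ x) pA /(_ x) aA; apply: filterS2 pA aA => w [A0 mA cA kA] aA.
by split.
Qed.

Variables (A : R -> Omega -> R) (w : Omega).
Hypothesis Aw : regular_path A w.

Lemma path_ge0 t : 0 <= t -> 0 <= A t w.
Proof. by case: Aw => A0 mA _ _ _ t0; rewrite -A0; exact: mA. Qed.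

Lemma path_le_total t : 0 <= t -> ((A t w)%:E <= total A w)%E.
Proof.
case: Aw => _ mA _ _ _ t0.
apply: (@le_trans _ _ (A (Num.trunc t).+1%:R w)%:E).
  by rewrite lee_fin mA// ltW// truncnS_gt.
by apply: ereal_sup_ubound; exists (Num.trunc t).+1.
Qed.

Lemma total_shift t : 0 <= t ->
  (total A w = (A t w)%:E + total A (Defs.shift M t w))%E.
Proof.
case: Aw => _ mA _ _ aA t0; apply/eqP; rewrite eq_le; apply/andP; split.
  apply: ge_ereal_sup => _ [n _ <-].
  apply: (@le_trans _ _ (A (t + n%:R) w)%:E).
    by rewrite lee_fin mA// lerDr.
  rewrite aA// EFinD leeD2l//; apply: ereal_sup_ubound; by exists n.
rewrite -leeBrDl//; apply: ge_ereal_sup => _ [n _ <-].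
rewrite leeBrDl// -EFinD -aA//.
by apply: path_le_total; rewrite addr_ge0.
Qed.

(** The shifted path is not known to be regular, but additivity with a zero increment shows that it
    starts from 0. *)
Lemma total_shift_ge0 t : 0 <= t -> (0 <= total A (Defs.shift M t w))%E.
Proof.
case: Aw => _ _ _ _ aA t0.
have := aA 0 t (lexx 0) t0; rewrite addr0 => /esym/eqP.
rewrite -subr_eq0 addrAC subrr add0r => /eqP e.
by apply: ereal_sup_ubound; exists 0%N => //; rewrite e.
Qed.

(** If [A t w] were positive, continuity at [t] would give an earlier rational time with a positive
    value. *)
Lemma path_before_increase t : 0 <= t -> (t%:E <= rational_increase A w)%E ->
  A t w = 0.
Proof.
case: Aw => A0 mA cA _ _; rewrite le_eqVlt => /predU1P[<-//|t0 tA].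
apply/eqP; rewrite eq_le path_ge0 ?(ltW t0)// andbT leNgt; apply/negP => At.
have /continuous_within_itvcyP[cA' _] := cA.
have ct : {for t, continuous (A ^~ w)} by apply: cA'; rewrite in_itv/= t0.
have : \forall s \near t, 0 < A s w by apply: (cvgr_gt (A t w) ct).
move=> /nbhs_ballP[e /= e0 eA].
have te : Num.max 0 (t - e) < t by rewrite gt_max t0/= gtrBl.
have [q] := rat_in_itvoo te.
rewrite in_itv/= gt_max -andbA => /and3P[q0 qe qt].
have Aq : 0 < A (ratr q) w.
  by apply: eA; rewrite /ball/= ger0_norm ?subr_ge0 ?(ltW qt)// ltrBlDr -ltrBlDl.
have := rational_increase_le (ltW (_ : 0 < q)) Aq; rewrite -(ltr0q R) => /(_ q0).
by move=> /(le_trans tA); rewrite lee_fin leNgt qt.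
Qed.

Lemma path_after_increase r : (rational_increase A w < r%:E)%E -> 0 < A r w.
Proof.
case: Aw => _ mA _ _ _ /rational_increase_lt[q [q0 Aq]]; rewrite lte_fin => qr.
by apply: (lt_le_trans Aq); apply: mA; rewrite ?ler0q// ltW.
Qed.

Lemma total_no_increase : rational_increase A w = +oo%E -> total A w = 0%E.
Proof.
move=> Aoo; apply/eqP; rewrite eq_le; apply/andP; split; last first.
  by have := path_le_total (lexx 0); case: Aw => -> _ _ _ _.
by apply: ge_ereal_sup => _ [n _ <-]; rewrite path_before_increase// Aoo leey.
Qed.

(** A killed path would freeze the functional at 0, whereas it is positive at every later time. *)
Lemma alive_at_increase t : rational_increase A w = t%:E -> Defs.coord M t w <> None.
Proof.
case: Aw => _ _ _ kA _ At Xt.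
have t0 : 0 <= t by rewrite -lee_fin -At rational_increase_ge0.
have : A (t + 1) w = 0.
  rewrite (kA t)// ?lerDl//; apply: path_before_increase => //.
  by rewrite At.
apply/eqP; rewrite gt_eqF//; apply: path_after_increase.
by rewrite At lte_fin ltrDl.
Qed.

Lemma increase_after_increase t : rational_increase A w = t%:E ->
  rational_increase A (Defs.shift M t w) = 0%E.
Proof.
case: Aw => _ _ _ _ aA At.
have t0 : 0 <= t by rewrite -lee_fin -At rational_increase_ge0.
apply/eqP; rewrite eq_le rational_increase_ge0 andbT; apply/lee_addgt0Pr => e e0.
have [q] := rat_in_itvoo e0; rewrite in_itv/= add0e => /andP[q0 qe].
have q0' : 0 <= q by rewrite -(ler0q R) ltW.
apply: (le_trans (rational_increase_le q0' _)); last by rewrite lee_fin ltW.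
have := aA (ratr q) t (ltW q0) t0.
rewrite (path_before_increase t0) ?At// add0r => <-.
by apply: path_after_increase; rewrite At lte_fin ltrDl.
Qed.

Lemma path_first_increase0 t : first_increase A w = 0%E -> 0 < t -> 0 < A t w.
Proof.
case: Aw => _ mA _ _ _ A0 t0.
have : (first_increase A w < t%:E)%E by rewrite A0 lte_fin.
move=> /ereal_inf_lt[_ [r [r0 Ar] <-]]; rewrite lte_fin => rt.
by apply: (lt_le_trans Ar); apply: mA => //; exact: ltW.
Qed.

End regular_paths.

Lemma filter_all_seq (T : Type) (F : set_system T) (I : eqType) (s : seq I)
    (P : I -> T -> Prop) : Filter F ->
  (forall i, i \in s -> F [set w | P i w]) ->
  F [set w | forall i, i \in s -> P i w].
Proof.
move=> FF; elim: s => [_|i s IH sP]; first by apply: filterS filterT.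
have Ps : F [set w | forall j, j \in s -> P j w].
  by apply: IH => j js; apply: sP; rewrite inE js orbT.
have Pi : F [set w | P i w] by apply: sP; rewrite inE eqxx.
apply: filterS2 Pi Ps => w Pi Ps j.
by rewrite inE => /orP[/eqP ->//|]; exact: Ps.
Qed.

(** * Hitting finite sets of points *)

Section hitting.
Context {R : realType} {dE dO : measure_display}.
Context {E : measurableType dE} {Omega : measurableType dO}.
Variables (M : strong_markov_process R E Omega) (L : E -> R -> Omega -> R).
Hypothesis hL : local_time_process M L.
Local Notation law := (Defs.law M).
Local Notation X := (Defs.coord M).

Lemma law_fin_num x (A : set Omega) : measurable A -> law x A \is a fin_num.
Proof.
move=> mA; rewrite ge0_fin_numE//; apply: (@le_lt_trans _ _ 1%E); last exact: ltey.
by rewrite -(prob_kernel (s := Defs.law M) x) le_measure// inE.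
Qed.

(* The hitting time of [s], up to null sets. *)
Definition hitting_time (s : seq E) (w : Omega) : \bar R :=
  \big[Order.min/+oo%E]_(y <- s) rational_increase (L y) w.

Lemma stopping_hitting_time s : stopping_time (filt M) (hitting_time s).
Proof.
apply: stopping_time_bigmin; first exact: filtP.
move=> y; apply: stopping_time_rational_increase; first exact: filtP.
by case: (hL y) => -[mA _ _] _ _; exact: mA.
Qed.

Lemma hitting_time_ge0 s w : (0 <= hitting_time s w)%E.
Proof. by case: (stopping_hitting_time s). Qed.

Lemma measurable_hitting_time0 s : measurable [set w | hitting_time s w = 0%E].
Proof.
rewrite (_ : [set _ | _] = [set w | (hitting_time s w <= 0%:E)%E]).
  case: (stopping_hitting_time s) => _ /(_ 0 (lexx 0)).
  by case: (filtP M) => _ mF _ _; exact: mF.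
apply/seteqP; split=> w /=; first by move=> ->.
by move=> T0; apply/eqP; rewrite eq_le T0 hitting_time_ge0.
Qed.

Lemma ae_regular_local_times x (s : seq E) :
  {ae law x, forall w, forall y, y \in s -> regular_path M (L y) w}.
Proof.
apply: (@filter_all_seq _ _ _ _ (fun y => regular_path M (L y))) => y _.
by apply: ae_regular_path; case: (hL y).
Qed.

(** Fine supports: started off [s], no local time at a point of [s] increases at once, and a zero
    minimum over a finite list is attained. *)
Lemma law_hitting_time0 (s : seq E) z : z \notin s ->
  law z [set w | hitting_time s w = 0%E] = 0%E.
Proof.
move=> zs; apply: measure_negligible; first exact: measurable_hitting_time0.
have : {ae law z, forall w, forall y, y \in s -> first_increase (L y) w <> 0%E}.
  apply: (@filter_all_seq _ _ _ _ (fun y w => first_increase (L y) w <> 0%E)) => y ys.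
  case: (hL y) => _ _; apply => zy.
  by rewrite zy ys in zs.
apply: negligibleS => w /= T0 sw.
have [_ [Too|[y ys Ty]]] := bigmin_pinfty s (fun y => rational_increase (L y) w).
  by move: T0; rewrite /hitting_time Too.
apply: (sw y ys); apply/eqP; rewrite eq_le; apply/andP; split.
  by rewrite -[leRHS]T0 /hitting_time Ty first_increase_le_rational.
by apply: le_ereal_inf_tmp => _ [t [t0 _] <-]; rewrite lee_fin.
Qed.

Lemma measurable_seq_points (s : seq E) : measurable [set z | z \in s].
Proof.
elim: s => [|y s IH].
  by rewrite (_ : [set _ | _] = set0)//; apply/seteqP; split.
rewrite (_ : [set _ | _] = [set y] `|` [set z | z \in s]).
  by apply: measurableU => //; exact: measurable_point M y.
apply/seteqP; split=> z /=; first by rewrite inE => /orP[/eqP ->|]; [left|right].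
by rewrite inE => -[->|->]; rewrite ?eqxx// orbT.
Qed.

(** At a finite hitting time the path is alive and its shift has hitting time 0. By the strong
    Markov property and [law_hitting_time0], this has probability 0 on the event that the current
    position is off [s]. *)
Lemma ae_hitting_point x (s : seq E) : {ae law x, forall w,
  hitting_time s w <> +oo%E -> exists2 z, z \in s & at_time X (hitting_time s) w = Some z}.
Proof.
set T := hitting_time s; have sT : stopping_time (filt M) T := stopping_hitting_time s.
pose Gam : set Omega := [set w | T w = 0%E].
pose A : set Omega := ~` (at_time X T @^-1` (Some @` [set z | z \in s])).
have sA : stopped_sigma_algebra (filt M) T A.
  apply: stopped_sigma_algebraC => //; first exact: filtP.
  by apply: stopped_measurable => //; exact: measurable_seq_points.
have mGam : measurable Gam by exact: measurable_hitting_time0.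
have mA : measurable (A `&` shifted_event X (Defs.shift M) T Gam).
  by apply: measurableI; [case: sA|exact: shifted_measurable].
have A0 : law x (A `&` shifted_event X (Defs.shift M) T Gam) = 0%E.
  rewrite strong_markov//; apply: integral0_eq => w Aw.
  case Xw : at_time => [y|//]; apply: law_hitting_time0.
  by apply/negP => ys; apply: Aw; exists y.
have nA : {ae law x, forall w, ~ (A `&` shifted_event X (Defs.shift M) T Gam) w}.
  by exists (A `&` shifted_event X (Defs.shift M) T Gam); split=> // w /= /contrapT.
apply: filterS2 nA (ae_regular_local_times x s) => w nA rw Tw.
have [_ [//|[y ys Ty]]] := bigmin_pinfty s (fun y => rational_increase (L y) w).
apply: contrapT => nX; apply: nA; split.
  by move=> /= [z zs zX]; apply: nX; exists z.
have {}Ty : T w = rational_increase (L y) w by [].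
have [t Tt] : exists t, T w = t%:E.
  by move: Tw (hitting_time_ge0 s w); rewrite -/T; case: (T w) => [t| |]// _ _; exists t.
exists t; split=> //; first by apply: (alive_at_increase (rw y ys)); rewrite -Ty.
apply/eqP; rewrite eq_le hitting_time_ge0 andbT.
rewrite -(increase_after_increase (rw y ys) (esym (etrans (esym Tt) Ty))).
by have [+ _] := bigmin_pinfty s (fun y => rational_increase (L y) (Defs.shift M t w)); apply.
Qed.

(** On [Az] the position at [T] is the constant [z], so the strong Markov property identifies the
    image of the restricted law under the shift with [law x Az] times [law z]; integrals follow from
    this equality of measures. *)
Lemma integral_strong_markov (T : Omega -> \bar R) (x z : E) (f : Omega -> \bar R) :
  stopping_time (filt M) T -> measurable_fun setT f -> (forall w, 0 <= f w)%E ->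
  let Az := at_time X T @^-1` [set Some z] in
  [/\ measurable Az,
    measurable_fun Az (fun w => f (Defs.shift M (fine (T w)) w)) &
    (\int[law x]_(w in Az) f (Defs.shift M (fine (T w)) w) =
     law x Az * \int[law z]_w f w)%E].
Proof.
move=> sT mf f0 Az.
have sAz : stopped_sigma_algebra (filt M) T Az.
  have := stopped_measurable sT (measurable_point M z).
  by rewrite image_set1.
have mAz : measurable Az by case: sAz.
(* [shifted_measurable] controls the shift where [T] is finite and the process alive, which holds on
   [Az]; the identity elsewhere makes [phi] measurable everywhere. *)
pose phi w : Omega := if `[< Az w >] then Defs.shift M (fine (T w)) w else w.
have phiAz Gam : Az `&` phi @^-1` Gam = Az `&` shifted_event X (Defs.shift M) T Gam.
  apply/seteqP; split=> w [Aw]; rewrite /= /phi asboolT//; move: (Aw).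
    rewrite /Az/= /at_time; case Tt : (T w) => [t| |]//= Xt Gw; split=> //.
    by exists t; split=> //; rewrite Xt.
  move=> _ [t [Tt _ Gw]]; split=> //.
  by rewrite Tt.
have mphi : measurable_fun setT phi.
  move=> _ Gam mGam; rewrite setTI.
  rewrite (_ : phi @^-1` Gam = (Az `&` phi @^-1` Gam) `|` (~` Az `&` Gam)).
    apply: measurableU; first by rewrite phiAz; apply: measurableI => //; exact: shifted_measurable.
    by apply: measurableI => //; exact: measurableC.
  apply/seteqP; split=> w /=.
    rewrite /phi; case: asboolP => Aw Gw; [left|right] => //.
  by case=> [[]//|[Aw Gw]]; rewrite /phi asboolF.
have Tphi w : Az w -> Defs.shift M (fine (T w)) w = phi w.
  by move=> Aw; rewrite /phi asboolT.
split=> //.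
  apply: (@eq_measurable_fun _ _ _ _ _ (f \o phi)).
    by move=> w /set_mem Aw /=; rewrite Tphi.
  by apply: measurable_funTS; exact: measurableT_comp.
have pfin : law x Az \is a fin_num by exact: law_fin_num.
have p0 : 0 <= fine (law x Az) by rewrite fine_ge0.
transitivity (\int[mscale (NngNum p0) (law z)]_w f w)%E; last first.
  by rewrite ge0_integral_mscale//= fineK.
transitivity (\int[pushforward (mrestr (law x) mAz) phi]_w f w)%E; last first.
  apply: eq_measure_integral => Gam mGam _; rewrite /= /mscale /pushforward/= /mrestr.
  rewrite setIC phiAz strong_markov// /mscale/= fineK//.
  rewrite (eq_integral (cst (law z Gam))); first by rewrite integral_cst// muleC.
  by move=> w /set_mem /= ->.
rewrite [RHS]ge0_integral_pushforward//= preimage_setT.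
rewrite [RHS](@ge0_negligible_integral _ _ _ _ _ (~` Az))//; last first.
- by rewrite /= /mrestr setICl measure0.
- exact: measurableT_comp.
- exact: measurableC.
rewrite setTD setCK; transitivity (\int[law x]_(w in Az) (f \o phi) w)%E.
  by apply: eq_integral => w /set_mem Aw; rewrite /= Tphi.
apply: eq_measure_integral => Gam mGam GAz.
by rewrite /= /mrestr setIidl.
Qed.

End hitting.

(** * Green functions split at a hitting time *)

Section green_hitting.
Context {R : realType} {dE dO : measure_display}.
Context {E : measurableType dE} {Omega : measurableType dO}.
Variables (M : strong_markov_process R E Omega) (L : E -> R -> Omega -> R).
Variable g : E -> E -> R.
Hypothesis hL : local_time_process M L.
Hypothesis hg : forall x y, green M L x y = (g x y)%:E.
Local Notation law := (Defs.law M).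
Local Notation X := (Defs.coord M).

(** Truncation at 0 alters [total] on a null set only and supplies the pointwise nonnegativity that
    [integral_strong_markov] requires. *)
Let f (y : E) (w : Omega) : \bar R := maxe (total (L y) w) 0%E.

Let measurable_total y : measurable_fun setT (total (L y)).
Proof.
rewrite (_ : total _ = fun w => esups (fun n => (L y n%:R w)%:E) 0); last first.
  apply/funext => w; rewrite /esups /total; congr ereal_sup.
  by apply/seteqP; split => _ [n _ <-]; exists n.
apply: (measurable_fun_esups (f := fun n w => (L y n%:R w)%:E)) => n.
apply/measurable_EFinP => _ B mB; rewrite setTI.
have [[mA _ _] _ _] := hL y; have [_ sF _ _] := filtP M.
by apply: (sF n%:R) => //; exact: mA.
Qed.

Let measurable_f y : measurable_fun setT (f y).
Proof. by apply: measurable_maxe. Qed.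

Let f_ge0 y w : (0 <= f y w)%E.
Proof. by rewrite le_max lexx orbT. Qed.

Let f_total y w : regular_path M (L y) w -> f y w = total (L y) w.
Proof.
move=> Lw; rewrite /f; apply/max_idPl.
by have := path_le_total Lw (lexx 0); case: (Lw) => -> _ _ _ _.
Qed.

Let integral_f z y : (\int[law z]_w f y w = (g z y)%:E)%E.
Proof.
rewrite -hg /green; apply: ae_eq_integral => //; first exact: measurable_total.
have [cA _ _] := hL y; apply: filterS (ae_regular_path z cA) => w Lw _.
exact: f_total.
Qed.

Lemma green_ge0 x y : 0 <= g x y.
Proof. by rewrite -lee_fin -integral_f integral_ge0. Qed.

(* Split the total local times at the hitting time [T] of [s]: those at points of [s]
   vanish before [T], while the one at [x] is already positive. *)
Lemma green_hitting (x : E) (s : seq E) : uniq s -> x \notin s ->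
  exists p : E -> R, [/\ forall z, 0 <= p z,
    forall y, y \in s -> g x y = \sum_(z <- s) p z * g z y &
    \sum_(z <- s) p z * g z x < g x x].
Proof.
move=> us xs; set T := hitting_time L s.
have sT : stopping_time (filt M) T := stopping_hitting_time hL s.
pose A z : set Omega := at_time X T @^-1` [set Some z].
pose th w := Defs.shift M (fine (T w)) w.
have SM z y := @integral_strong_markov _ _ _ _ _ M T x z (f y) sT (measurable_f y) (f_ge0 y).
have mA z : measurable (A z) by case: (SM z z).
(* The hitting distribution of [s] from [x]. *)
pose p z := fine (law x (A z)).
have p_ge0 z : 0 <= p z by rewrite fine_ge0.
have intA z y : (\int[law x]_(w in A z) f y (th w) = (p z * g z y)%:E)%E.
  have [_ _ ->] := SM z y.
  by rewrite integral_f EFinM fineK//; exact: law_fin_num.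
(* The local time at [y] accumulated after [T], and 0 when [T] is infinite. *)
pose D y w : \bar R := (\sum_(z <- s) ((fun w => f y (th w)) \_ (A z)) w)%E.
have D_ge0 y w : (0 <= D y w)%E.
  by apply: sume_ge0 => z _; apply: erestrict_ge0.
have mD1 z y : measurable_fun setT ((fun w => f y (th w)) \_ (A z)).
  by apply/(measurable_restrictT _ (mA z)); case: (SM z y).
have mD y : measurable_fun setT (D y) by exact: emeasurable_sum.
have intD y : (\int[law x]_w D y w = (\sum_(z <- s) p z * g z y)%:E)%E.
  rewrite ge0_integral_sum//=; last by move=> z w _; apply: erestrict_ge0.
  rewrite -sumEFin; apply: eq_bigr => z _.
  by rewrite -intA [RHS]integral_mkcond.
have Dz y w z : z \in s -> at_time X T w = Some z -> D y w = f y (th w).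
  move=> zs Xz; rewrite /D (bigD1_seq z)//= patchE mem_set// big1 ?adde0// => z' z'z.
  rewrite patchE memNset//= /A/= Xz => -[/esym/eqP].
  by rewrite (negPf z'z).
have Doo y w : T w = +oo%E -> D y w = 0%E.
  move=> Too; rewrite /D big1// => z _; rewrite patchE memNset//= /A/= /at_time.
  by rewrite Too.
have path : {ae law x, forall w, [/\
    forall y, y \in x :: s -> regular_path M (L y) w,
    first_increase (L x) w = 0%E,
    forall y, y \in s -> first_increase (L y) w <> 0%E &
    T w <> +oo%E -> exists2 z, z \in s & at_time X T w = Some z]}.
  have [_ x0 _] := hL x.
  have s0 : {ae law x, forall w, forall y, y \in s -> first_increase (L y) w <> 0%E}.
    apply: (@filter_all_seq _ _ _ _ (fun y w => first_increase (L y) w <> 0%E)) => y ys.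
    have [_ _] := hL y; apply => xy.
    by move: xs; rewrite xy ys.
  have x0s0 : {ae law x, forall w, first_increase (L x) w = 0%E /\
      forall y, y \in s -> first_increase (L y) w <> 0%E}.
    by apply: filterS2 x0 s0 => w.
  apply: filterS3 (ae_regular_local_times hL x (x :: s)) x0s0
    (ae_hitting_point hL x s) => w ? [? ?] ?.
  by split.
have fD y w t : regular_path M (L y) w -> T w = t%:E ->
    forall z, z \in s -> at_time X T w = Some z -> f y w = ((L y t w)%:E + D y w)%E.
  move=> Lw Tt z zs Xz; have t0 : 0 <= t by rewrite -lee_fin -Tt (hitting_time_ge0 hL).
  rewrite (Dz _ _ z)// f_total// (total_shift Lw t0) /th Tt/=; congr (_ + _)%E.
  by apply/esym/max_idPl; exact: (total_shift_ge0 Lw t0).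
have Tcase w : T w = +oo%E \/ exists t, T w = t%:E.
  have := hitting_time_ge0 hL s w; rewrite -/T.
  by case: (T w) => [t _|//|//]; [right; exists t|left].
have T_le y w : y \in s -> (T w <= rational_increase (L y) w)%E.
  by move=> ys; have [+ _] := bigmin_pinfty s (fun y => rational_increase (L y) w); apply.
exists p; split=> // [y ys|].
- apply/EFin_inj; rewrite -integral_f -intD; apply: ae_eq_integral => //.
  apply: filterS path => w [Lw _ _ Tw] _.
  have Ly : regular_path M (L y) w by apply: Lw; rewrite inE ys orbT.
  have [Too|[t Tt]] := Tcase w.
    rewrite Doo// f_total// (total_no_increase Ly)//; apply/eqP.
    by rewrite -leye_eq -Too T_le.
  have [|z zs Xz] := Tw; first by rewrite Tt.
  rewrite (fD _ _ _ Ly Tt z)// (path_before_increase Ly) ?add0e//.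
    by rewrite -lee_fin -Tt (hitting_time_ge0 hL).
  by rewrite -Tt T_le.
(* If the local time after [T] is infinite, adding a positive amount is not strict; this alternative
   is discarded below by integrability of [f x]. *)
- have fDlt : {ae law x, forall w, (D x w < f x w \/ f x w = +oo)%E}.
    apply: filterS path => w [Lw x0 s0 Tw].
    have Lx : regular_path M (L x) w by apply: Lw; rewrite inE eqxx.
    have pos t : 0 < t -> 0 < L x t w by exact: (path_first_increase0 Lx x0).
    have [Too|[t Tt]] := Tcase w.
      left; rewrite Doo// f_total//; apply: (@lt_le_trans _ _ (L x 1 w)%:E).
        by rewrite lte_fin pos.
      exact: (path_le_total Lx).
    have [|z zs Xz] := Tw; first by rewrite Tt.
    have t0 : 0 < t.
      rewrite lt_neqAle -lee_fin -Tt (hitting_time_ge0 hL) andbT; apply/eqP => t0.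
      have [_ [Too|[y ys Ty]]] := bigmin_pinfty s (fun y => rational_increase (L y) w).
        by move: Tt; rewrite /T /hitting_time Too.
      apply: (s0 y ys); apply/eqP; rewrite eq_le; apply/andP; split.
        apply: (le_trans (first_increase_le_rational (L y) w)).
        by rewrite -Ty -/(hitting_time L s w) -/T Tt -t0.
      by apply: le_ereal_inf_tmp => _ [r [r0 _] <-]; rewrite lee_fin.
    rewrite (fD _ _ _ Lx Tt z)//; have := D_ge0 x w.
    case: (D x w) => [r _|_|//]; last by right.
    by left; rewrite -EFinD lte_fin ltrDr pos.
  have if_ : (law x).-integrable setT (f x).
    apply/integrableP; split; first exact: measurable_f.
    by under eq_integral do rewrite gee0_abs//; rewrite integral_f ltey.
  have iD : (law x).-integrable setT (D x).
    apply/integrableP; split => //.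
    by under eq_integral do rewrite gee0_abs//; rewrite intD ltey.
  have ffin := integrable_ae measurableT if_.
  have lex : \sum_(z <- s) p z * g z x <= g x x.
    rewrite -lee_fin -integral_f -intD; apply: ae_ge0_le_integral => //.
    by apply: filterS fDlt => w [/ltW//|-> _]; rewrite leey.
  (* Equal integrals would make the almost surely nonnegative [f x - D x] vanish almost surely,
     against [fDlt]. *)
  rewrite lt_neqAle lex andbT; apply/eqP => e.
  have int0 : (\int[law x]_w `|f x w - D x w| = 0)%E.
    rewrite (ae_eq_integral (fun w => f x w - D x w)%E)//=.
    - by rewrite integralB// integral_f intD e -EFinB subrr.
    - by apply: measurableT_comp => //; exact: emeasurable_funB.
    - exact: emeasurable_funB.
    - apply: filterS2 fDlt ffin => w Df fw _; rewrite gee0_abs//.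
      have {}fw := fw I; case: Df => [/ltW|foo]; last by rewrite foo in fw.
      by rewrite sube_ge0// fw orbT.
  have mfD : measurable_fun setT (fun w => f x w - D x w)%E by exact: emeasurable_funB.
  have fDeq := (ae_eq_integral_abs (law x) measurableT mfD).1 int0.
  have PF : ProperFilter (almost_everywhere (law x)).
    by apply: ae_properfilter_algebraOfSetsType; rewrite prob_kernel.
  have absurd : {ae law x, forall w, False}.
    apply: filterS3 fDeq fDlt ffin => w h Df fw; have {}fw := fw I.
    case: Df => [Df|foo]; last by rewrite foo in fw.
    have /eqP : (f x w - D x w = 0)%E := h I.
    rewrite sube_eq//.
    rewrite add0e => /eqP fDw.
    by rewrite fDw ltxx in Df.
  by have [] := filter_ex absurd.
Qed.

End green_hitting.

(** Row [i] is [green_hitting] from [y i] towards the other points: [p] has zero diagonal, the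
    equalities there are the zero off-diagonal entries, and the strict inequality is the positivity
    of [h]. *)
Lemma green_matrix_factorization (R : realType) (dE dO : measure_display)
    (E : measurableType dE) (Omega : measurableType dO)
    (M : strong_markov_process R E Omega) (L : E -> R -> Omega -> R)
    (g : E -> E -> R) (k : nat) (y : 'I_k -> E) :
  local_time_process M L -> (forall x y : E, green M L x y = (g x y)%:E) ->
  injective y ->
  exists (p : 'M[R]_k) (h : 'rV[R]_k),
    [/\ forall i j, 0 <= p i j, forall i, 0 < h 0 i &
    (1%:M - p) *m (\matrix_(i < k, j < k) g (y i) (y j)) = diag_mx h].
Proof.
move=> hL hg injy.
pose s i := [seq y j | j <- enum 'I_k & j != i].
have us i : uniq (s i) by rewrite map_inj_uniq// filter_uniq// enum_uniq.
have ys i j : (y j \in s i) = (j != i).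
  by rewrite mem_map// mem_filter mem_enum andbT.
have ysi i : y i \notin s i by rewrite ys eqxx.
have /choice[q qP] := fun i => green_hitting hL hg (us i) (ysi i).
have sumE i j : \sum_l (if l == i then 0 else q i (y l)) * g (y l) (y j) =
    \sum_(z <- s i) q i z * g z (y j).
  rewrite big_map big_filter big_enum_cond/= (bigID (fun l => l != i))/=.
  rewrite [X in _ + X]big1 ?addr0 => [|l /negPn ->]; last by rewrite mul0r.
  by apply: eq_bigr => l /negPf ->.
exists (\matrix_(i, j) if j == i then 0 else q i (y j)).
exists (\row_i (g (y i) (y i) - \sum_(z <- s i) q i z * g z (y i))).
split=> [i j|i|].
- by rewrite mxE; case: ifP => // _; have [q0 _ _] := qP i.
- by rewrite mxE subr_gt0; have [_ _ ->] := qP i.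
- apply/matrixP => i j; rewrite mulmxBl mul1mx !mxE.
  under eq_bigr do rewrite !mxE.
  rewrite sumE; have [<-|ij] := eqVneq i j; first by rewrite mulr1n.
  by have [_ qE _] := qP i; rewrite mulr0n -(qE (y j)) ?subrr// ys eq_sym.
Qed.

Theorem theorem3p1 (R : realType) (dE dO : measure_display)
    (E : measurableType dE) (Omega : measurableType dO)
    (M : strong_markov_process R E Omega) (L : E -> R -> Omega -> R)
    (g : E -> E -> R)
    (htrans : transient M)
    (hL : local_time_process M L)
    (hg : forall x y : E, green M L x y = (g x y)%:E)
    (beta : R) (hbeta : 0 < beta) :
  exists (d' : measure_display) (Omega' : measurableType d')
    (Q : probability Omega' R) (psi : E -> {RV Q >-> R}),
    (forall x w, 0 <= psi x w) /\
    forall (n : nat) (a : 'rV[R]_n) (x : 'I_n -> E),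
      (forall i, 0 <= a 0 i) ->
      ('E_Q[fun w => expR (- (2^-1) * \sum_(i < n) a 0 i * psi (x i) w)] =
       ((\det (1%:M + diag_mx a *m (\matrix_(i < n, j < n) g (x i) (x j))))
          `^ (- beta^-1))%:E)%E.
Proof.
have b0 : 0 <= beta^-1 by rewrite invr_ge0 ltW.
have g0 := green_ge0 hL hg.
have [Lam pLam LamE] := laplace_permanental b0 g0
  (fun k y => green_matrix_factorization hL hg (y := y)).
(* The case of no point, where the determinant of the empty matrix is 1. *)
have Lam1 : Lam (fun=> 1) = 1.
  have := LamE 0%N 0 (fun i => False_rect _ (notF (ltn_ord i)))
    (fun i => False_rect _ (notF (ltn_ord i))).
  rewrite det_mx00 powR1; apply: etrans; congr Lam; apply/funext => v.
  by rewrite big_ord0 oppr0 expR0.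
(* The one-point transform is a power of [1 + a * g x x] and tends to 1 as [a] decreases to 0;
   finiteness of [g x x] thus keeps mass from escaping to infinity. *)
have tight x e : 0 < e ->
    exists2 a, 0 < a & 1 - e < Lam (fun v => expR (- (a * (v x)%:num))).
  move=> e0.
  have LamxE a : 0 <= a ->
      Lam (fun v => expR (- (a * (v x)%:num))) = (1 + a * g x x) `^ (- beta^-1).
    move=> a0; have := LamE 1%N (const_mx a) (fun=> x).
    under [X in Lam X]eq_fun do rewrite big_ord1 mxE.
    move=> -> => [|i]; last by rewrite mxE.
    by rewrite det_mx11 !mxE big_ord1 !mxE eqxx !mulr1n.
  have cv : (1 + n.+1%:R^-1 * g x x) `^ (- beta^-1) @[n --> \oo] --> (1 : R) `^ (- beta^-1).
    apply: (@continuous_cvg _ _ _ _ _ _ (@powR R ^~ (- beta^-1))).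
      exact: continuous_powR_base.
    rewrite -[X in _ --> X]addr0 -(mul0r (g x x)).
    apply: cvgD; first exact: cvg_cst.
    by apply: cvgMl; exact: cvg_harmonic.
  rewrite powR1 in cv.
  have [n ne] : exists n, 1 - e < (1 + n.+1%:R^-1 * g x x) `^ (- beta^-1).
    have near1 : \forall n \near \oo, 1 - e < (1 + n.+1%:R^-1 * g x x) `^ (- beta^-1).
      by apply: (cvgr_gt 1 cv); rewrite gtrBl.
    by have [n ?] := filter_ex near1; exists n.
  by exists n.+1%:R^-1; rewrite ?invr_gt0// LamxE ?invr_ge0.
have [d' [T [Q [psi [psi0 psiE]]]]] := exists_random_field pLam Lam1 tight.
exists d', T, Q, psi; split=> // n a x a0.
by rewrite (psiE n (fun i => a 0 i) x a0) LamE.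
Qed.
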